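(* Let $\mathbb{F}$ be a finite field. Let $P$ be a set of points and $L$ a set of lines in $\mathbb{F}^2$ such that $|P|=|L|=N$. Moreover, assume that $$|I(P,L)|\ge K^{-1}N^{3/2}.$$ Then, for a large absolute constant $C$, there exist: (i) subfields $G_1,G_2\subseteq\mathbb{F}$ such that $|G_1|,|G_2|\le CK^CN^{1/2}$; (ii) sets of the form $S_1=a_1+b_1\cdot G_1$ and $S_2=a_2+b_2\cdot G_2$; (iii) a projective transformation $T$, such that $$|(S_1\times S_2)\cap T(P)|\ge C^{-1}K^{-C}|P|.$$
   Context: $I(P,L)=\{(x,\ell)\in P\times L:x\in\ell\}$; $K$ is a positive real parameter, and $a_1,b_1,a_2,b_2$ are elements of $\mathbb{F}$. The projective plane over $\mathbb{F}$ is $\mathbb{F}^3\setminus\{(0,0,0)\}$ modulo dilations; $\mathbb{F}^2$ is embedded in it by $(x,y)\mapsto(x,y,1)$, its complement being the line at infinity. A projective transformation $T$ is the map of the projective plane induced by an invertible $3\times3$ matrix over $\mathbb{F}$. For $A\subseteq\mathbb{F}^2$, $T(A)\subseteq\mathbb{F}^2$ denotes the set obtained by embedding $A$ in the projective plane, applying $T$, and mapping back to $\mathbb{F}^2$ via $(x,y,1)\mapsto(x,y)$; points sent by $T$ to the line at infinity are lost in this process.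
   Formalization: The formal theorem adds the hypothesis N > (CK)^C: without it the claim fails (e.g. N = K = 1, one point on one line over a prime field with more than C elements, which has no subfield of size at most C). *)

(* Defs.v *)
From HB Require Import structures.
From mathcomp Require Import all_boot all_order all_algebra all_field.
From mathcomp Require Import reals exp.

Set Implicit Arguments.
Unset Strict Implicit.
Unset Printing Implicit Defensive.

Import Order.TTheory GRing.Theory Num.Theory.
Local Open Scope ring_scope.

Definition is_line (F : finFieldType) (l : {set F * F}) : Prop :=
  exists a b c : F,
    (a, b) != (0, 0) /\ l = [set p : F * F | a * p.1 + b * p.2 == c].

Definition incidences (F : finFieldType)
    (P : {set F * F}) (L : {set {set F * F}}) : {set (F * F) * {set F * F}} :=
  [set xl in setX P L | xl.1 \in xl.2].

(* In a field [x / 0 = 0], so closure under division needs no restriction to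
   nonzero denominators. *)
Definition is_subfield (F : finFieldType) (G : {set F}) : Prop :=
  GRing.divring_closed (mem G).

Definition affine_image (F : finFieldType) (a b : F) (G : {set F}) : {set F} :=
  [set a + b * g | g in G].

(* Homogeneous coordinates (x, y, 1) of the affine point (x, y). *)
Definition homog (F : finFieldType) (p : F * F) : 'cV[F]_3 :=
  \col_(i < 3) [:: p.1; p.2; 1]`_i.

(* Equality of the projective points represented by u and v, for u, v nonzero. *)
Definition same_proj (F : finFieldType) (u v : 'cV[F]_3) : bool :=
  [exists c : F, (c != 0) && (u == c *: v)].

(* The image of A under the projective transformation induced by M.  A point of
   A sent to the line at infinity is related to no [homog q], so it is lost. *)
Definition proj_image (F : finFieldType) (M : 'M[F]_3) (A : {set F * F}) :
    {set F * F} :=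
  [set q | [exists p in A, same_proj (M *m homog p) (homog q)]].

(* Main.v *)
Require Import Defs.
From HB Require Import structures.
From mathcomp Require Import all_boot all_order all_algebra all_field.
From mathcomp Require Import reals exp.
From mathcomp Require Import zify ring lra.

Set Implicit Arguments.
Unset Strict Implicit.
Unset Printing Implicit Defensive.

Import Order.TTheory GRing.Theory Num.Theory.
Local Open Scope ring_scope.

(** Proof idea. Discard the lines and points of too high multiplicity and count
    paths: some point [p] and two lines [l1], [l2] through it are such that very
    many lines meet [l1], [l2] and a third line through [p] in points of the set.
    Send [p] to infinity so that the lines through [p] become the horizontal lines
    [u = const] and the others [t = x + u y], with [x] and [y] read off on [l1] and
    [l2].  Thus [x + u y] lies in a set of size about [sqrt N] for a positive
    proportion of all [(x, y, u)] in a product of three such sets.  The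
    Balog-Szemeredi-Gowers argument, applied in [x] and then in [y], gives dense
    sets [X], [Y] of small doubling, hence an approximate group [H], and [u / u0]
    multiplies [H] into few translates of [H] for many [u].  Such "good" multipliers
    are closed under the field operations up to the loss in the constants, but there
    are too few of them for [(a, b) |-> a + x b] to be injective on good [a], [b]; so
    every good [x] is a quotient of differences of good multipliers, and these
    quotients form a subfield [G].  Finally [X] and [u0 Y] are covered by few
    translates of one dilate [e G], which puts many points in a projective image of
    [e G * u0 G]. *)

(** * Counting *)

(** A single scale [m], equal to [sqrt N] up to powers of the constants, is used for everything:
    each one-dimensional set has at most [m] elements and each density hypothesis has the form
    [m ^ j <= k * count], so every loss is polynomial in [k]. The lines [l1] and [l2] become [u = 0]
    and [u = infinity]. A line missing [p] is recovered from its intersections with them, and its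
    intersection with a third line of the pencil is the point [(x + u y, u)]. Multiplication enters
    only through [u]: up to coverings, [u Y] has the additive structure of [X] for every popular
    [u], and comparing two values of [u] produces good multipliers. The obstacle is that each field
    operation worsens the constant, so iteration would ruin it. Being a quotient of differences is a
    condition without a constant and itself implies a fixed one; passing through it after each
    operation resets the loss. One subfield serves both factors, with different dilations, and the
    translations are absorbed into the projective map. The lower bound on [N] makes [m ^ 2] exceed
    constant multiples of [m], and absorbs the incidences lost by pruning. *)

Section Counting.
Local Open Scope nat_scope.

Lemma card_sum (T : finType) (P : pred T) :
  #|[set x | P x]| = \sum_x (P x : nat).
Proof. by rewrite -sum1_card big_mkcond /=; apply: eq_bigr => x _; rewrite inE. Qed.

Lemma pigeonhole (I : finType) (A : pred I) (f : I -> nat) (m s : nat) :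
  s <= \sum_(i | A i) f i -> #|A| <= m -> 0 < s ->
  exists2 i, A i & s <= m * f i.
Proof.
move=> hs hA s0.
case: (pickP [pred i | A i && (s <= m * f i)]) => [i /andP[Ai hi]|h].
  by exists i.
have h1 : m * \sum_(i | A i) f i <= \sum_(i | A i) s.-1.
  rewrite big_distrr /=; apply: leq_sum => i Ai.
  by move: (h i); rewrite /= Ai /= => /negbT; lia.
rewrite sum_nat_const in h1.
have : m * s <= #|A| * s.-1 by apply: leq_trans h1; rewrite leq_mul2l hs orbT.
have : #|A| * s.-1 <= m * s.-1 by rewrite leq_mul2r hA orbT.
have : m = 0 -> \sum_(i | A i) f i = 0.
  move=> m0; rewrite big_pred0 // => i.
  by apply: (card0_eq (A := A)); apply/eqP; rewrite -leqn0 -m0.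
nia.
Qed.

(** Terms below half the average [s / m] add up to at most [s / 2], so dropping them costs a factor
    2. Later this often takes the place of a convexity inequality. *)
Lemma popular (I : finType) (A : pred I) (f : I -> nat) (m s : nat) :
  s <= \sum_(i | A i) f i -> #|A| <= m ->
  s <= 2 * \sum_(i | A i && (s <= 2 * m * f i)) f i.
Proof.
move=> hs hA; have [->|s0] := posnP s; first by [].
have [m0|m0] := posnP m.
  have : \sum_(i | A i) f i = 0.
    rewrite big_pred0 // => i.
    by apply: (card0_eq (A := A)); apply/eqP; rewrite -leqn0 -m0.
  lia.
move: hs; rewrite (bigID (fun i => s <= 2 * m * f i)) /= => hs.
have h1 : 2 * m * \sum_(i | A i && ~~ (s <= 2 * m * f i)) f i <= m * s.
  apply: (@leq_trans (\sum_(i | A i && ~~ (s <= 2 * m * f i)) s)).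
    rewrite big_distrr /=; apply: leq_sum => i /andP[_]; lia.
  rewrite sum_nat_const leq_mul2r; apply/orP; right.
  apply: leq_trans hA; apply: subset_leq_card; apply/subsetP => i.
  by rewrite unfold_in /= => /andP[].
nia.
Qed.

Lemma sum_le_exists (I : finType) (A : pred I) (f g : I -> nat) :
  \sum_(i | A i) g i <= \sum_(i | A i) f i -> (exists i, A i) ->
  exists2 i, A i & g i <= f i.
Proof.
move=> h [i0 Ai0].
case: (pickP [pred i | A i && (g i <= f i)]) => [i /andP[Ai hi]|h'].
  by exists i.
have : \sum_(i | A i) f i < \sum_(i | A i) g i.
  rewrite (bigD1 i0) //= [X in _ < X](bigD1 i0) //=.
  rewrite -addSn leq_add //.
    by move: (h' i0); rewrite /= Ai0 /= => /negbT; rewrite -ltnNge.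
  apply: leq_sum => i /andP[Ai _].
  by move: (h' i); rewrite /= Ai /= => /negbT; lia.
by rewrite ltnNge h.
Qed.

Lemma sum_Cauchy (I : finType) (A : pred I) (f : I -> nat) :
  (\sum_(i | A i) f i) ^ 2 <= #|A| * \sum_(i | A i) f i ^ 2.
Proof.
rewrite -(leq_pmul2l (isT : 0 < 2)).
have -> : 2 * (\sum_(i | A i) f i) ^ 2
   = \sum_(i | A i) \sum_(j | A j) 2 * (f i * f j).
  rewrite expnS expn1 big_distrlr /= big_distrr /=.
  by apply: eq_bigr => i _; rewrite big_distrr.
have -> : 2 * (#|A| * \sum_(i | A i) f i ^ 2)
   = \sum_(i | A i) \sum_(j | A j) (f i ^ 2 + f j ^ 2).
  rewrite [RHS](eq_bigr (fun i => #|A| * f i ^ 2 + \sum_(j | A j) f j ^ 2)).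
    by rewrite big_split /= sum_nat_const -big_distrr /= addnn mul2n.
  by move=> i _; rewrite big_split /= sum_nat_const.
by apply: leq_sum => i _; apply: leq_sum => j _; exact: nat_Cauchy.
Qed.

End Counting.

(** * Sumsets and coverings *)

Section Sumsets.
Variable V : finZmodType.
Implicit Types A B C H Z : {set V}.

Definition sumset A B : {set V} := [set a + b | a in A, b in B].
Definition oppset A : {set V} := [set - a | a in A].

Lemma mem_sumset A B a b : a \in A -> b \in B -> a + b \in sumset A B.
Proof. exact: imset2_f. Qed.

Lemma mem_diffset A B a b : a \in A -> b \in B -> a - b \in sumset A (oppset B).
Proof. by move=> aA bB; apply: mem_sumset => //; apply: imset_f. Qed.

Lemma sumsetP A B x :
  reflect (exists a b, [/\ a \in A, b \in B & x = a + b]) (x \in sumset A B).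
Proof.
apply: (iffP imset2P) => [[a b aA bB ->]|[a [b [aA bB ->]]]]; first by exists a, b.
by exists a b.
Qed.

Lemma diffsetP A B x :
  reflect (exists a b, [/\ a \in A, b \in B & x = a - b])
          (x \in sumset A (oppset B)).
Proof.
apply: (iffP (sumsetP _ _ _)) => [[a [_ [aA /imsetP[b bB ->] ->]]]|[a [b [aA bB ->]]]].
  by exists a, b.
by exists a, (- b); split=> //; apply: imset_f.
Qed.

Lemma sumsetC A B : sumset A B = sumset B A.
Proof.
by apply/setP => x; apply/sumsetP/sumsetP => -[a [b [aA bB ->]]]; exists b, a;
  rewrite addrC.
Qed.

Lemma sumsetA A B C : sumset A (sumset B C) = sumset (sumset A B) C.
Proof.
apply/setP => x; apply/sumsetP/sumsetP.
  move=> [a [_ [aA /sumsetP[b [c [bB cC ->]]] ->]]].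
  by exists (a + b), c; rewrite addrA; split=> //; apply: mem_sumset.
move=> [_ [c [/sumsetP[a [b [aA bB ->]]] cC ->]]].
by exists a, (b + c); rewrite addrA; split=> //; apply: mem_sumset.
Qed.

Lemma oppsetK A : oppset (oppset A) = A.
Proof. by rewrite /oppset -imset_comp (eq_imset _ (@opprK V)) imset_id. Qed.

Lemma oppset_sum A B : oppset (sumset A B) = sumset (oppset A) (oppset B).
Proof.
apply/setP => x; apply/imsetP/sumsetP.
  move=> [_ /sumsetP[a [b [aA bB ->]]] ->].
  by exists (- a), (- b); rewrite opprD; split=> //; apply: imset_f.
move=> [_ [_ [/imsetP[a aA ->] /imsetP[b bB ->] ->]]].
by exists (a + b); rewrite ?opprD //; apply: mem_sumset.
Qed.

Lemma card_oppset A : #|oppset A| = #|A|.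
Proof. by rewrite card_imset //; exact: oppr_inj. Qed.

Lemma subset_sumset A B A' B' :
  A \subset A' -> B \subset B' -> sumset A B \subset sumset A' B'.
Proof. by move=> sA sB; apply: imset2S. Qed.

Lemma card_sumset_le A B : (#|sumset A B| <= #|A| * #|B|)%N.
Proof.
rewrite -cardsX; apply: leq_trans (leq_imset_card (fun x => x.1 + x.2) _).
apply: subset_leq_card; apply/subsetP => _ /sumsetP[a [b [aA bB ->]]].
by apply/imsetP; exists (a, b); rewrite ?inE ?aA.
Qed.

Lemma leq_card_sumset A B b : b \in B -> (#|A| <= #|sumset A B|)%N.
Proof.
move=> bB; rewrite -(card_imset _ (addIr b)); apply: subset_leq_card.
by apply/subsetP => _ /imsetP[a aA ->]; apply: mem_sumset.
Qed.

(** Covering numbers multiply under composition and sums and survive dilation. Sumset sizes are thus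
    controlled by coverings, without Plünnecke-type inequalities. *)
Definition covers (k : nat) H A : Prop :=
  exists2 Z : {set V}, (#|Z| <= k)%N & A \subset sumset Z H.

Lemma covers_sub k H A A' : A' \subset A -> covers k H A -> covers k H A'.
Proof. by move=> sA [Z hZ sZ]; exists Z => //; apply: subset_trans sA sZ. Qed.

Lemma covers_supset k H H' A : H \subset H' -> covers k H A -> covers k H' A.
Proof.
move=> sH [Z hZ sZ]; exists Z => //; apply: subset_trans sZ _.
exact: subset_sumset.
Qed.

Lemma covers_leq k k' H A : (k <= k')%N -> covers k H A -> covers k' H A.
Proof. by move=> hk [Z hZ sZ]; exists Z => //; apply: leq_trans hk. Qed.

Lemma covers_refl H : covers 1 H H.
Proof.
exists [set 0]; rewrite ?cards1 //; apply/subsetP => x xH.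
by apply/sumsetP; exists 0, x; rewrite add0r inE.
Qed.

Lemma covers_card k H A : covers k H A -> (#|A| <= k * #|H|)%N.
Proof.
move=> [Z hZ /subset_leq_card/leq_trans -> //].
by apply: leq_trans (card_sumset_le _ _) _; rewrite leq_mul2r hZ orbT.
Qed.

Lemma covers_trans k j H B A :
  covers k B A -> covers j H B -> covers (k * j) H A.
Proof.
move=> [Z hZ sZ] [Y hY sY]; exists (sumset Z Y).
  by apply: leq_trans (card_sumset_le _ _) _; apply: leq_mul.
by apply: subset_trans sZ _; rewrite -sumsetA; apply: subset_sumset.
Qed.

Lemma covers_sum k j H H' A A' : covers k H A -> covers j H' A' ->
  covers (k * j) (sumset H H') (sumset A A').
Proof.
move=> [Z hZ sZ] [Y hY sY]; exists (sumset Z Y).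
  by apply: leq_trans (card_sumset_le _ _) _; apply: leq_mul.
apply: subset_trans (subset_sumset sZ sY) _.
by rewrite -!sumsetA (sumsetA H) (sumsetC H) -(sumsetA Y).
Qed.

Lemma covers_opp k H A : covers k H A -> covers k (oppset H) (oppset A).
Proof.
move=> [Z hZ sZ]; exists (oppset Z); first by rewrite card_oppset.
by rewrite -oppset_sum; apply: imsetS.
Qed.

(* A maximal family of disjoint translates of [B] by elements of [A]. *)
Lemma Ruzsa_covering k A B : (0 < #|B|)%N -> (#|sumset A B| <= k * #|B|)%N ->
  covers k (sumset B (oppset B)) A.
Proof.
move=> B0 hAB.
pose D (Z : {set V}) := (Z \subset A) && [forall z in Z, forall z' in Z,
  forall b in B, forall b' in B, (z + b == z' + b') ==> (z == z')].
have D0 : D set0.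
  by rewrite /D sub0set; apply/forall_inP => z; rewrite inE.
have [Z /maxsetP[/andP[sZ /forall_inP dZ] mZ] _] := maxset_exists D0.
have injZ z z' b b' : z \in Z -> z' \in Z -> b \in B -> b' \in B ->
    z + b = z' + b' -> z = z'.
  move=> zZ z'Z bB b'B e.
  have /forall_inP/(_ _ z'Z)/forall_inP/(_ _ bB)/forall_inP/(_ _ b'B) := dZ z zZ.
  by rewrite e eqxx => /eqP.
exists Z.
  rewrite -(leq_pmul2r B0); apply: leq_trans hAB.
  rewrite -cardsX -(card_in_imset (f := fun x => x.1 + x.2)).
    apply: subset_leq_card; apply/subsetP => _ /imsetP[[z b] /setXP[zZ bB] ->] /=.
    by apply: mem_sumset => //; apply: (subsetP sZ).
  move=> [z b] [z' b'] /setXP[zZ bB] /setXP[z'Z b'B] /= e.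
  have ez := injZ _ _ _ _ zZ z'Z bB b'B e.
  by rewrite ez in e *; rewrite (addrI _ e).
apply/subsetP => a aA.
have [aZ|aZ] := boolP (a \in Z).
  have /card_gt0P[b bB] := B0.
  by apply/sumsetP; exists a, (b - b); rewrite subrr addr0 -(subrr b) mem_diffset.
apply: contraNT aZ => na.
have far z b b' : z \in Z -> b \in B -> b' \in B -> a + b != z + b'.
  move=> zZ bB b'B; apply: contraNneq na => e.
  apply/sumsetP; exists z, (b' - b); rewrite mem_diffset //; split=> //.
  by rewrite addrA -e addrK.
rewrite -(mZ (a |: Z)) ?subsetUr //; first by rewrite !inE eqxx.
rewrite /D subUset sub1set aA sZ /=.
apply/forall_inP => z /setU1P zZ; apply/forall_inP => z' /setU1P z'Z.
apply/forall_inP => b bB; apply/forall_inP => b' b'B.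
apply/implyP => /eqP e; apply/eqP.
case: zZ z'Z e => [->|zZ] [->|z'Z] //.
- by move/eqP; rewrite (negbTE (far _ _ _ _ _ _)).
- by move/esym/eqP; rewrite (negbTE (far _ _ _ _ _ _)).
- exact: injZ.
Qed.

End Sumsets.

(** * Approximate groups *)

Section ApproxGroup.
Variable V : finZmodType.
Implicit Types A B H : {set V}.

Definition reps A d := #|[set x in A | x + d \in A]|.

(** If [A - A] has at most [k * #|A|] elements, a difference has on average at least [#|A| / k]
    representations; the threshold is half of that. *)
Definition popular_diffs (k : nat) A : {set V} :=
  [set d | (#|A| <= 2 * k * reps A d)%N].

Lemma reps_opp A d : reps A (- d) = reps A d.
Proof.
rewrite /reps -(card_imset _ (addIr (- d))); apply: eq_card => y.
rewrite !inE; apply/imsetP/andP => [[x]|[yA ydA]].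
  by rewrite inE => /andP[xA xd] ->; rewrite subrK xd xA.
by exists (y + d); rewrite ?addrK // inE ydA addrK.
Qed.

Lemma oppset_popular_diffs k A : oppset (popular_diffs k A) = popular_diffs k A.
Proof.
apply/setP => d; apply/imsetP/idP => [[x]|dS].
  by rewrite inE => xS ->; rewrite inE reps_opp.
by exists (- d); rewrite ?opprK // inE reps_opp; rewrite inE in dS.
Qed.

Section PopularDiffs.
Variables (k : nat) (A : {set V}).
Hypothesis A_gt0 : (0 < #|A|)%N.
Hypothesis smallA : (#|sumset A (oppset A)| <= k * #|A|)%N.
Let S := popular_diffs k A.

Lemma doubling_gt0 : (0 < k)%N.
Proof.
have /card_gt0P[a aA] := A_gt0.
case: k smallA => //; rewrite mul0n leqn0 => /eqP/cards0_eq/setP/(_ (a - a)).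
by rewrite inE mem_diffset.
Qed.

Lemma zero_popular : 0 \in S.
Proof.
rewrite inE /reps; have -> : [set x in A | x + 0 \in A] = A.
  by apply/setP => x; rewrite inE addr0 andbb.
by rewrite -{1}(mul1n #|A|) leq_mul2r; have := doubling_gt0; lia.
Qed.

(* With [s = y - x] one has [b + s - a = (b - x) + (y - a)], so every element
   of [B + S - A] has many representations in [(B - A) + (A - A)]. *)
Lemma card_add_popular B :
  (#|sumset (sumset B S) (oppset A)| <= 2 * k ^ 2 * #|sumset B (oppset A)|)%N.
Proof.
set E := sumset (sumset B S) _; set U := sumset B _; set W := sumset A (oppset A).
have hrep e : e \in E -> (#|A| <= 2 * k * #|[set u in U | (e - u)%R \in W]|)%N.
  move=> /diffsetP[_ [a [/sumsetP[b [s [bB]]] + ->] aA ->]].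
  rewrite inE => /leq_trans -> //; rewrite leq_mul2l; apply/orP; right.
  rewrite -[reps A s](card_imset _ (subrI b)).
  apply: subset_leq_card; apply/subsetP => _ /imsetP[x + ->].
  rewrite !inE => /andP[xA xsA]; rewrite mem_diffset //=.
  have -> : b + s - a - (b - x) = x + s - a.
    by rewrite opprB addrC !addrA subrK.
  exact: mem_diffset.
(* Double counting of pairs [(e, u)] with [e - u] in [W]: each [e] has at least [#|A| / (2 k)]
   partners, each [u] at most [#|W|]. *)
have h : (#|E| * #|A| <= 2 * k * (#|U| * #|W|))%N.
  rewrite -sum_nat_const.
  apply: (@leq_trans (\sum_(e in E) 2 * k * #|[set u in U | (e - u)%R \in W]|)).
    exact: leq_sum.
  rewrite -big_distrr /= leq_mul2l; apply/orP; right.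
  rewrite (eq_bigr (fun e => \sum_(u in U) nat_of_bool ((e - u)%R \in W))%N); last first.
    move=> e _; rewrite card_sum [RHS]big_mkcond /=; apply: eq_bigr => u _.
    by case: (u \in U).
  rewrite exchange_big /= -sum_nat_const; apply: leq_sum => u _.
  apply: (@leq_trans #|[set e | (e - u)%R \in W]|).
    by rewrite card_sum big_mkcond; apply: leq_sum => e _; case: ifP.
  rewrite -(card_imset _ (addIr (- u))); apply: subset_leq_card.
  by apply/subsetP => _ /imsetP[e + ->]; rewrite inE.
rewrite -(leq_pmul2r A_gt0); apply: leq_trans h _.
have : (#|U| * #|W| <= #|U| * (k * #|A|))%N by rewrite leq_mul2l smallA orbT.
by rewrite -(leq_pmul2l (ltn0Sn 1)); have := doubling_gt0; nia.
Qed.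

(** Popular differences account for at least half of the [#|A| ^ 2] pairs, and each of them for at
    most [#|A|]. *)
Lemma leq_card_popular : (#|A| <= 2 * #|S|)%N.
Proof.
have hsum : (#|A| * #|A| <= \sum_(d in sumset A (oppset A)) reps A d)%N.
  rewrite (eq_bigr (fun d => \sum_(x in A) nat_of_bool ((x + d)%R \in A))%N); last first.
    move=> d _; rewrite /reps card_sum [RHS]big_mkcond /=; apply: eq_bigr => x _.
    by case: (x \in A).
  rewrite exchange_big /= -sum_nat_const; apply: leq_sum => x xA.
  rewrite big_mkcond /=.
  rewrite -(card_imset A (addIr (- x))) -[X in (X <= _)%N]sum1_card big_mkcond /=.
  apply: leq_sum => d _; case: imsetP => // -[y yA ->].
  by rewrite mem_diffset // addrC subrK yA.
have := popular hsum smallA; set T := (\sum_(_ | _) _)%N => hT.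
have : (T <= #|S| * #|A|)%N.
  rewrite -sum_nat_const /T big_mkcond [X in (_ <= X)%N]big_mkcond /=.
  apply: leq_sum => d _.
  case: ifP => // /andP[_ h]; rewrite inE.
  have -> : (#|A| <= 2 * k * reps A d)%N.
    by rewrite -(leq_pmul2l A_gt0); move: h; move: (reps A d) #|A| => r a; lia.
  by apply: subset_leq_card; apply/subsetP => x; rewrite inE => /andP[].
by move=> h; rewrite -(leq_pmul2r A_gt0); nia.
Qed.

End PopularDiffs.

Definition approx_group (k : nat) H :=
  oppset H = H /\ covers k H (sumset H H).

(** The group is [S + S] for the set [S] of popular differences. Each further summand [S] costs a
    factor [2 k ^ 2]; five summands give [32 k ^ 10], and passing from [#|A|] to [#|S|] doubles
    this. Ruzsa covering by [S - S = S + S] then covers the fourfold sum. *)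
Lemma ex_approx_group k A : (0 < #|A|)%N ->
  (#|sumset A (oppset A)| <= k * #|A|)%N ->
  exists H, [/\ approx_group (64 * k ^ 10) H, covers (64 * k ^ 10) H A,
    (#|A| <= 2 * #|H|)%N & (#|H| <= 64 * k ^ 10 * #|A|)%N].
Proof.
move=> A0 hA; have k0 := doubling_gt0 A0 hA.
have /card_gt0P[a aA] := A0.
pose S := popular_diffs k A.
have oS : oppset S = S := oppset_popular_diffs k A.
have S0 : 0 \in S := zero_popular A0 hA.
have AS : (#|A| <= 2 * #|S|)%N := leq_card_popular A0 hA.
have cS := card_add_popular A0 hA.
have aA' : - a \in oppset A by exact: imset_f.
pose S2 := sumset S S; pose S3 := sumset S2 S; pose S4 := sumset S3 S.
have h1 : (#|sumset S (oppset A)| <= 2 * k ^ 2 * #|A|)%N.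
  have := cS [set 0].
  have e B : sumset [set 0] B = B.
    apply/setP => x; apply/sumsetP/idP => [[z [b [/set1P -> bB ->]]]|xB].
      by rewrite add0r.
    by exists 0, x; rewrite inE add0r.
  by rewrite !e card_oppset.
have h2 := leq_trans (cS S) (leq_mul (leqnn _) h1).
have h3 := leq_trans (cS S2) (leq_mul (leqnn _) h2).
have h4 := leq_trans (cS S3) (leq_mul (leqnn _) h3).
have h5 := leq_trans (cS S4) (leq_mul (leqnn _) h4).
have up B : (#|B| <= #|sumset B (oppset A)|)%N by apply: leq_card_sumset aA'.
exists S2; split.
- split; first by rewrite oppset_sum oS.
  have -> : sumset S2 S2 = S4 by rewrite /S4 /S3 -sumsetA.
  rewrite /S2 -{2}oS; apply: Ruzsa_covering; first by lia.
  apply: leq_trans (up _) _; apply: leq_trans h5 _.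
  apply: (@leq_trans (32 * k ^ 10 * #|A|)); first by nia.
  have : (32 * k ^ 10 * #|A| <= 32 * k ^ 10 * (2 * #|S|))%N.
    by rewrite leq_mul2l AS orbT.
  nia.
- rewrite /S2 -{2}oS; apply: Ruzsa_covering; first by lia.
  rewrite -card_oppset oppset_sum oS sumsetC; apply: leq_trans h1 _.
  have : (k ^ 2 <= k ^ 10)%N by rewrite leq_pexp2l.
  nia.
- by apply: leq_trans AS _; rewrite leq_mul2l (leq_card_sumset _ S0).
- apply: leq_trans (up _) _; apply: leq_trans h2 _.
  have : (k ^ 4 <= k ^ 10)%N by rewrite leq_pexp2l.
  nia.
Qed.

End ApproxGroup.

(** * Good multipliers *)

Section Multipliers.
Variable F : finFieldType.
Implicit Types (A B H M : {set F}) (k : nat) (x y : F).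

Definition dilate x A : {set F} := [set x * a | a in A].

Lemma card_dilate x A : x != 0 -> #|dilate x A| = #|A|.
Proof. by move=> x0; apply: card_imset; apply: mulfI. Qed.

Lemma dilateM x y A : dilate x (dilate y A) = dilate (x * y) A.
Proof. by rewrite /dilate -imset_comp; apply: eq_imset => a /=; rewrite mulrA. Qed.

Lemma dilate1 A : dilate 1 A = A.
Proof. by rewrite /dilate (eq_imset _ (@mul1r F)) imset_id. Qed.

Lemma dilate_sumset x A B :
  dilate x (sumset A B) = sumset (dilate x A) (dilate x B).
Proof.
apply/setP => z; apply/imsetP/sumsetP.
  move=> [_ /sumsetP[a [b [aA bB ->]]] ->].
  by exists (x * a), (x * b); rewrite mulrDr; split=> //; apply: imset_f.
move=> [_ [_ [/imsetP[a aA ->] /imsetP[b bB ->] ->]]].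
by exists (a + b); rewrite ?mulrDr //; apply: mem_sumset.
Qed.

Lemma dilate_oppset x A : dilate x (oppset A) = oppset (dilate x A).
Proof.
by rewrite /dilate /oppset -!imset_comp; apply: eq_imset => a /=; rewrite mulrN.
Qed.

Lemma covers_dilate k x A B : covers k A B -> covers k (dilate x A) (dilate x B).
Proof.
move=> [Z hZ sZ]; exists (dilate x Z).
  exact: leq_trans (leq_imset_card _ _) hZ.
by rewrite -dilate_sumset; apply: imsetS.
Qed.

(** If [H] were a subfield, the good multipliers with [k = 1] would be exactly its elements. *)
Definition good_mult k H x := covers k H (dilate x H).

Lemma good_mult_leq k k' H x : (k <= k')%N -> good_mult k H x -> good_mult k' H x.
Proof. exact: covers_leq. Qed.

Lemma good_mult1 H : good_mult 1 H 1.
Proof. by rewrite /good_mult dilate1; apply: covers_refl. Qed.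

Lemma good_mult0 H : (0 < #|H|)%N -> good_mult 1 H 0.
Proof.
move=> /card_gt0P[h hH]; exists [set - h]; rewrite ?cards1 //.
apply/subsetP => _ /imsetP[a _ ->]; rewrite mul0r -(addNr h).
by apply: mem_sumset => //; rewrite inE.
Qed.

Lemma good_multM k j H x y :
  good_mult k H x -> good_mult j H y -> good_mult (j * k) H (x * y).
Proof.
by move=> gx gy; rewrite /good_mult -dilateM; apply: covers_trans gx; apply: covers_dilate.
Qed.

Section ApproxGroupMultipliers.
Variables (K : nat) (H : {set F}).
Hypothesis H_gt0 : (0 < #|H|)%N.
Hypothesis agH : approx_group K H.

Lemma approx_group_gt0 : (0 < K)%N.
Proof.
have [_ [Z hZ sZ]] := agH; apply: leq_trans hZ; have /card_gt0P[h hH] := H_gt0.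
have /sumsetP[z [? [zZ _ _]]] := subsetP sZ _ (mem_sumset hH hH).
by apply/card_gt0P; exists z.
Qed.

Lemma good_multD k j x y :
  good_mult k H x -> good_mult j H y -> good_mult (k * j * K) H (x + y).
Proof.
move=> gx gy; apply: covers_trans agH.2.
apply: covers_sub (covers_sum gx gy); apply/subsetP => _ /imsetP[h hH ->].
by rewrite mulrDl; apply: mem_sumset; apply: imset_f.
Qed.

Lemma good_multN k x : good_mult k H x -> good_mult k H (- x).
Proof.
move=> gx; have [oH _] := agH; rewrite /good_mult -oH.
have -> : dilate (- x) (oppset H) = oppset (dilate x (oppset H)).
  rewrite [in RHS]dilate_oppset oppsetK /dilate /oppset -imset_comp.
  by apply: eq_imset => a /=; rewrite mulrN mulNr opprK.
by apply: covers_opp; rewrite oH.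
Qed.

Lemma good_multB k j x y :
  good_mult k H x -> good_mult j H y -> good_mult (k * j * K) H (x - y).
Proof. by move=> gx gy; apply: good_multD => //; apply: good_multN. Qed.

Lemma good_mult_gt0 k x : good_mult k H x -> (0 < k)%N.
Proof.
move=> [Z hZ sZ]; apply: leq_trans hZ; have /card_gt0P[h hH] := H_gt0.
have /sumsetP[z [? [zZ _ _]]] := subsetP sZ _ (imset_f (fun a => x * a) hH).
by apply/card_gt0P; exists z.
Qed.

(** Dilation by [x] shows that [x^-1 H + H] is as large as [H + x H], which is covered by [k * K]
    translates of [H]. Ruzsa covering then covers [x^-1 H] by translates of [H - H = H + H], at the
    cost of one more [K]. *)
Lemma good_multV k x : good_mult k H x -> good_mult (k * K * K) H x^-1.
Proof.
have K0 := approx_group_gt0.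
move=> gx; have k0 := good_mult_gt0 gx.
have [->|x0] := eqVneq x 0.
  by rewrite invr0; apply: good_mult_leq (good_mult0 H_gt0); rewrite !muln_gt0 k0 K0.
have [oH cH] := agH.
rewrite /good_mult; apply: (covers_trans _ cH); rewrite -{2}oH.
apply: Ruzsa_covering => //.
rewrite -(card_dilate _ x0) dilate_sumset dilateM divff // dilate1.
apply: covers_card; rewrite sumsetC; apply: (covers_trans _ cH).
by rewrite -(muln1 k); apply: covers_sum gx (covers_refl _).
Qed.

Lemma good_mult_div k j x y :
  good_mult k H x -> good_mult j H y -> good_mult (j * K * K * k) H (x / y).
Proof. by move=> gx gy; apply: good_multM => //; apply: good_multV. Qed.

(* If [x] is good then [x * (b - d)] lies in [H + H] for many pairs [b, d] of [H];
   the pair [b <> d] that works for most [x] gives the dilation [e = b - d]. *)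
Lemma good_mult_dense k (G : {set F}) : (0 < k)%N ->
  (forall x, x \in G -> good_mult k H x) -> (2 * k ^ 2 <= #|H|)%N ->
  exists2 e, e != 0 &
    (#|G| <= 2 * k ^ 2 * #|[set x in G | (x * e)%R \in sumset H H]|)%N.
Proof.
move=> k0 gG hk; have [oH _] := agH.
pose off := [set bd in setX H H | bd.1 != bd.2].
have many x : x \in G ->
    (#|H| ^ 2 <= 2 * k ^ 2 * #|[set bd in off | (x * (bd.1 - bd.2))%R \in sumset H H]|)%N.
  move=> /gG[Z hZ sZ].
  (* One translate [z + H] receives [x b] for at least [#|H| / k] elements [b]; these form [D], and
     [z] cancels in differences. The diagonal pairs, at most [#|H|] of them, are negligible because
     [2 k ^ 2 <= #|H|]. *)
  have : (#|H| <= \sum_(z in Z) #|[set b in H | (x * b - z)%R \in H]|)%N.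
    rewrite (eq_bigr (fun z => \sum_(b in H) nat_of_bool ((x * b - z)%R \in H))%N).
      rewrite exchange_big /= -[X in (X <= _)%N]sum1_card; apply: leq_sum => b bH.
      have /sumsetP[z [h [zZ hH e]]] := subsetP sZ _ (imset_f (fun a => x * a) bH).
      by rewrite (bigD1 z) //= e addrC addrA addNr add0r hH.
    move=> z _; rewrite card_sum [RHS]big_mkcond /=; apply: eq_bigr => b _.
    by case: (b \in H).
  move=> /pigeonhole/(_ hZ H_gt0)[z zZ]; set D := [set b in H | _] => hD.
  have sD : setX D D \subset [set bd in setX H H | (x * (bd.1 - bd.2))%R \in sumset H H].
    apply/subsetP => -[b d] /setXP[]; rewrite !inE /= => /andP[bH hb] /andP[dH hd].
    rewrite bH dH /=.
    have -> : x * (b - d) = (x * b - z) - (x * d - z) by ring.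
    by rewrite -{2}oH mem_diffset.
  have := subset_leq_card sD; rewrite cardsX.
  set E := [set bd in off | _]; set E' := [set bd in setX H H | _].
  have : (#|E'| <= #|E| + #|H|)%N.
    rewrite -(card_imset H (f := fun h => (h, h))); last by move=> ? ? [].
    apply: leq_trans (leq_card_setU _ _); apply: subset_leq_card.
    apply/subsetP => -[b d]; rewrite !inE /= => /andP[/andP[bH dH] hx].
    rewrite bH dH hx /= andbT; have [->|] //= := eqVneq b d.
    exact: imset_f.
  move: hk hD H_gt0; move: #|H| #|D| #|E| #|E'| => h d c c' hk hD _ h1 h2.
  have h3 : (h ^ 2 <= k ^ 2 * d ^ 2)%N by rewrite -expnMn leq_exp2r.
  have h4 : (k ^ 2 * (d * d) <= k ^ 2 * (c + h))%N.
    by rewrite leq_mul2l (leq_trans h2 h1) orbT.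
  have h5 : (2 * k ^ 2 * h <= h * h)%N by rewrite leq_mul2r hk orbT.
  by move: h3 h4 h5; rewrite !expnS !expn0; lia.
have [/eqP G0|G0] := posnP #|G|.
  by exists 1; rewrite ?oner_eq0 // (eqP G0).
have : (#|G| * #|H| ^ 2 <= \sum_(bd in off)
    2 * k ^ 2 * #|[set x in G | (x * (bd.1 - bd.2))%R \in sumset H H]|)%N.
  rewrite -sum_nat_const; apply: (@leq_trans (\sum_(x in G)
    2 * k ^ 2 * #|[set bd in off | (x * (bd.1 - bd.2))%R \in sumset H H]|)).
    exact: leq_sum.
  rewrite -!big_distrr /= leq_mul2l; apply/orP; right.
  rewrite (eq_bigr (fun x => \sum_(bd in off)
    nat_of_bool ((x * (bd.1 - bd.2))%R \in sumset H H))%N).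
    rewrite exchange_big /=; apply: leq_sum => bd _.
    by rewrite card_sum big_mkcond /=; apply: leq_sum => x _; case: (x \in G).
  move=> x _; rewrite card_sum [RHS]big_mkcond /=; apply: eq_bigr => b _.
  by case: (b \in off).
have co : (#|off| <= #|H| ^ 2)%N.
  rewrite expnS expn1 -cardsX; apply: subset_leq_card.
  by apply/subsetP => bd; rewrite inE => /andP[].
move=> /pigeonhole/(_ co)[]; first by rewrite muln_gt0 G0 expn_gt0 H_gt0.
move=> [b d]; rewrite !inE /= => /andP[_ bd] h; exists (b - d).
  by rewrite subr_eq0.
have : (0 < #|H| ^ 2)%N by rewrite expn_gt0 H_gt0.
by move: h; rewrite mulnC => h h0; rewrite -(leq_pmul2l h0).
Qed.

(** A single dilation sends a fixed proportion of [G] into [H + H]. This is the upper bound that an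
    injective map on pairs of good multipliers would violate. *)
Lemma card_good_mult k (G : {set F}) : (0 < k)%N ->
  (forall x, x \in G -> good_mult k H x) -> (2 * k ^ 2 <= #|H|)%N ->
  (#|G| <= 2 * k ^ 2 * K * #|H|)%N.
Proof.
move=> k0 gG hk; have [e e0 h] := good_mult_dense k0 gG hk.
apply: leq_trans h _; rewrite -!mulnA !leq_mul2l; do 3!(apply/orP; right).
apply: leq_trans (covers_card agH.2).
rewrite -(card_imset _ (mulIf e0)); apply: subset_leq_card.
by apply/subsetP => _ /imsetP[x + ->]; rewrite inE => /andP[].
Qed.

(* Multipliers outside the quotient set [Q] of [M] give injective maps
   [(a, b) |-> a + x b] on [M * M], hence too many good multipliers: good
   multipliers lie in [Q].  Conversely all of [Q] is good, so [Q] is closed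
   under the field operations. *)
Lemma good_mult_subfield k1 k2 k3 k M :
  k1 = (k ^ 4 * K ^ 4)%N -> k2 = (k1 ^ 2 * K ^ 2)%N -> k3 = (k ^ 2 * k2 * K)%N ->
  (1 < #|M|)%N ->
  (forall x, x \in M -> good_mult k H x) ->
  (2 * k3 ^ 2 <= #|H|)%N -> (2 * k3 ^ 2 * K * #|H| < #|M| ^ 2)%N ->
  exists G, [/\ is_subfield G, M \subset G & forall x, x \in G -> good_mult k2 H x].
Proof.
move=> e1 e2 e3 M1 gM h1 h2; have K0 := approx_group_gt0.
have [m mM] : exists m, m \in M by apply/card_gt0P; apply: ltn_trans M1.
have k0 : (0 < k)%N := good_mult_gt0 (gM _ mM).
have k10 : (0 < k1)%N by rewrite e1 muln_gt0 ?expn_gt0 k0 K0.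
(* The constants are costs: [k1] of a quotient of two differences of elements of [M], [k2] of one
   field operation on [k1]-good elements, [k3] of [a + x b] with [x] being [k2]-good and [a], [b] in
   [M]. *)
have k20 : (0 < k2)%N by rewrite e2 muln_gt0 ?expn_gt0 k10 K0.
have k30 : (0 < k3)%N by rewrite e3 !muln_gt0 ?expn_gt0 k0 k20 K0.
pose Q : {set F} := [set x | [exists a in M, exists b in M, exists c in M,
  exists d in M, (c != d) && (x == (a - b) / (c - d))]].
have memQ a b c d : a \in M -> b \in M -> c \in M -> d \in M -> c != d ->
    (a - b) / (c - d) \in Q.
  move=> aM bM cM dM cd; rewrite inE.
  apply/exists_inP; exists a => //; apply/exists_inP; exists b => //.
  apply/exists_inP; exists c => //; apply/exists_inP; exists d => //.
  by rewrite cd eqxx.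
have Qgood x : x \in Q -> good_mult k1 H x.
  rewrite inE => /exists_inP[a aM /exists_inP[b bM /exists_inP[c cM]]].
  move=> /exists_inP[d dM /andP[_ /eqP ->]].
  have := good_mult_div (good_multB (gM a aM) (gM b bM)) (good_multB (gM c cM) (gM d dM)).
  by apply: good_mult_leq; rewrite e1; lia.
have goodQ x : good_mult k2 H x -> x \in Q.
  move=> gx; apply: contraLR h2 => xQ; rewrite -leqNgt.
  pose f (ab : F * F) := ab.1 + x * ab.2.
  have inj : {in setX M M &, injective f}.
    move=> [a b] [c d] /setXP[aM bM] /setXP[cM dM]; rewrite /f /= => e.
    have [bd|bd] := eqVneq d b; first by move: e; rewrite bd => /addIr ->.
    move: xQ; have -> : x = (a - c) / (d - b).
      apply: (canRL (mulfK _)); first by rewrite subr_eq0.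
      by rewrite mulrBr -[x * d](addKr c) -e; ring.
    by rewrite memQ.
  rewrite expnS expn1 -cardsX -(card_in_imset inj).
  apply: card_good_mult => // _ /imsetP[[a b] /setXP[aM bM] ->].
  have := good_multD (gM a aM) (good_multM gx (gM b bM)).
  by apply: good_mult_leq; rewrite e3; lia.
have k1K : (k1 <= k2)%N.
  by rewrite e2 expnS expn1 -mulnA leq_pmulr // muln_gt0 k10 expn_gt0 K0.
exists Q; split.
- split.
  + by apply: goodQ; apply: good_mult_leq (good_mult1 H).
  + move=> x y xQ yQ; apply: goodQ; have := good_multB (Qgood _ xQ) (Qgood _ yQ).
    by apply: good_mult_leq; rewrite e2 (expnS k1) expn1 leq_mul2l expnS expn1 leq_pmulr ?orbT.
  + move=> x y xQ yQ; apply: goodQ; have := good_mult_div (Qgood _ xQ) (Qgood _ yQ).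
    by apply: good_mult_leq; rewrite e2; lia.
- apply/subsetP => x xM; apply: goodQ; apply: good_mult_leq (gM x xM).
  rewrite e2 e1; have : (0 < k ^ 7 * K ^ 10)%N by rewrite muln_gt0 ?expn_gt0 k0 K0.
  nia.
- by move=> x xQ; apply: good_mult_leq (Qgood x xQ).
Qed.

End ApproxGroupMultipliers.
End Multipliers.

(** * The Balog-Szemeredi-Gowers argument *)

Section BalogSzemerediGowers.
Local Open Scope nat_scope.
Variables (U : finZmodType) (V D : finType).
Variables (T : U -> V -> bool) (A : {set U}) (B : {set V}) (E : {set D}).
Variables (dat : V -> U -> U -> D) (dval : D -> U) (m k : nat).
Hypothesis TA : forall x v, T x v -> x \in A.
Hypothesis TB : forall x v, T x v -> v \in B.
Hypothesis m_gt0 : 0 < m.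
Hypothesis cardA : #|A| <= m.
Hypothesis cardB : #|B| <= m ^ 2.
Hypothesis cardE : #|E| <= m ^ 3.
Hypothesis datE : forall x x' v, T x v -> T x' v -> dat v x x' \in E.
Hypothesis datK : forall x x' v, T x v -> T x' v -> dval (dat v x x') = (x - x')%R.
Hypothesis dat_inj : forall x x' v v', T x v -> T x' v -> T x v' -> T x' v' ->
  dat v x x' = dat v' x x' -> v = v'.
Hypothesis denseT : m ^ 3 <= k * \sum_(x in A) #|[set v | T x v]|.

Let deg x := #|[set v | T x v]|.
Let codeg x x' := #|[set v | T x v && T x' v]|.
(** Chosen so that deleting the vertices with many bad partners removes at most [m / (16 k ^ 2)]
    vertices. Each has degree at most [m ^ 2], so at least half of a degree sum of size
    [m ^ 3 / (8 k ^ 2)] remains. *)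
Let b := 512 * k ^ 4.
Let bad x x' := b * codeg x x' < m ^ 2.
Let badpairs v := \sum_(x in A) \sum_(x' in A) (T x v && T x' v && bad x x').

Let bad_sym x x' : bad x x' = bad x' x.
Proof. by rewrite /bad /codeg; congr (_ * _ < _); apply: eq_card => v; rewrite !inE andbC. Qed.

Let deg_le x : deg x <= m ^ 2.
Proof.
apply: leq_trans cardB; apply: subset_leq_card; apply/subsetP => v.
by rewrite inE => /TB.
Qed.

Let sum_deg2 : m ^ 5 <= 4 * k ^ 2 * \sum_(x in A) deg x * deg x.
Proof.
set W := \sum_(x in A) deg x; set S := \sum_(x in A) _.
have h := popular (leqnn W) cardA.
have h1 : W * W <= 4 * m * S.
  apply: leq_trans (leq_mul (leqnn W) h) _.
  rewrite mulnCA -[4]/(2 * 2) -!mulnA leq_mul2l /= mulnA big_distrr /= [in leqRHS]big_distrr /=.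
  rewrite big_mkcond [leqRHS]big_mkcond /=; apply: leq_sum => x _.
  case: (x \in A) => //=; case: ifP => // hx.
  by rewrite mulnA leq_mul2r hx orbT.
have h2 : m ^ 3 * m ^ 3 <= (k * W) * (k * W) by apply: leq_mul.
have h3 : k ^ 2 * (W * W) <= k ^ 2 * (4 * m * S) by rewrite leq_mul2l h1 orbT.
by rewrite -(leq_pmul2l m_gt0); move: h2 h3; clear; clearbody W S; lia.
Qed.

Let sum_badpairs : b * \sum_(v in B) badpairs v <= m ^ 4.
Proof.
have -> : \sum_(v in B) badpairs v
    = \sum_(x in A) \sum_(x' in A) (if bad x x' then codeg x x' else 0).
  rewrite /badpairs exchange_big /=; apply: eq_bigr => x _.
  rewrite exchange_big /=; apply: eq_bigr => x' _.
  case: (bad x x').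
    rewrite /codeg card_sum big_mkcond /=; apply: eq_bigr => v _.
    rewrite andbT; case: ifP => // vB; case: (T x v) (@TB x v) => //= /(_ isT).
    by rewrite vB.
  by rewrite big1 // => v _; rewrite andbF.
rewrite big_distrr /=.
apply: (@leq_trans (\sum_(x in A) \sum_(x' in A) m ^ 2)).
  apply: leq_sum => x _; rewrite big_distrr /=; apply: leq_sum => x' _.
  by case: ifP => [/ltnW //|]; rewrite muln0.
rewrite !sum_nat_const; have := leq_mul cardA (leq_mul cardA (leqnn (m ^ 2))).
by lia.
Qed.

(** The same [v] must have neighbours of large total degree and few bad pairs among them, so the two
    demands are averaged as one sum. Over [B] each side of it amounts to at most [m ^ 5], which
    turns the 4 of [sum_deg2] into 8. *)
Let popular_vertex : exists2 v, v \in B &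
  m ^ 3 + b * m * badpairs v <= 8 * k ^ 2 * \sum_(x in A | T x v) deg x.
Proof.
have e : \sum_(v in B) \sum_(x in A | T x v) deg x = \sum_(x in A) deg x * deg x.
  rewrite (exchange_big_dep (mem A)) /=; last by move=> v x _ /andP[].
  apply: eq_bigr => x xA; rewrite sum_nat_const; congr (_ * _).
  rewrite /deg; apply: eq_card => v; rewrite inE unfold_in /= xA /=.
  by case: (T x v) (@TB x v) => [/(_ isT) ->|]; rewrite ?andbF.
apply: sum_le_exists.
  rewrite big_split /= sum_nat_const -!big_distrr /= e.
  have h1 : #|B| * m ^ 3 <= m ^ 2 * m ^ 3 by rewrite leq_mul2r cardB orbT.
  have h2 : m * (b * \sum_(v in B) badpairs v) <= m * m ^ 4 by rewrite leq_mul2l sum_badpairs orbT.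
  move: h1 h2 sum_deg2; set s1 := \sum_(_ in B) _; set s2 := \sum_(_ in A) _.
  by move: #|B| => cB; lia.
have [B0|/set0Pn//] := eqVneq B set0.
move: sum_deg2; rewrite -e B0 big_set0 muln0 leqn0 expn_eq0.
by move: m_gt0; case: m.
Qed.

(* [A'] is chosen inside the neighbourhood of a random [v], after deleting the
   vertices that form many bad pairs.  Every difference of [A'] then has many
   representations as [dval e + dval e'] with [e], [e'] in [E], through an
   intermediate element forming no bad pair with the two ends. *)
Lemma Balog_Szemeredi_Gowers : exists A' : {set U}, [/\ A' \subset A,
  #|sumset A' (oppset A')| <= 16 * k ^ 2 * (512 * k ^ 4) ^ 2 * m &
  m ^ 3 <= 16 * k ^ 2 * \sum_(x in A') #|[set v | T x v]|].
Proof.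
have [v vB hv] := popular_vertex; set s := \sum_(_ in A | _) _ in hv.
pose X := [set x | T x v].
have XA : X \subset A by apply/subsetP => x; rewrite inE => /TA.
have es : s = \sum_(x in X) deg x.
  apply: eq_bigl => x; rewrite inE.
  by case: (T x v) (@TA x v) => [/(_ isT) ->|]; rewrite ?andbF.
have s_le : s <= #|X| * m ^ 2 by rewrite es -sum_nat_const; apply: leq_sum.
pose nb x := #|[set x' in X | bad x x']|.
(* With the threshold at a quarter, any two elements of [X'] leave at least half of [X] forming a
   bad pair with neither. *)
pose X' := [set x in X | 4 * nb x <= #|X|].
have ebad : badpairs v = \sum_(x in X) nb x.
  rewrite /badpairs big_mkcond [RHS]big_mkcond /=; apply: eq_bigr => x _.
  rewrite inE; case: (boolP (T x v)) => [Tx|nTx]; last first.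
    by case: ifP => // _; rewrite big1 // => x' _.
  rewrite (TA Tx) /nb card_sum big_mkcond /=; apply: eq_bigr => x' _.
  rewrite inE; case: (boolP (T x' v)) => //= [Tx'|nTx']; first by rewrite (TA Tx').
  by case: ifP.
have hrem : #|X :\: X'| * #|X| <= 4 * badpairs v.
  rewrite ebad big_distrr /= -sum_nat_const big_mkcond [leqRHS]big_mkcond /=.
  apply: leq_sum => x _; rewrite !inE; case: (T x v) => //=.
  by rewrite andbT; case: ifP => //; rewrite -ltnNge => /ltnW.
have m3 : m ^ 3 <= 8 * k ^ 2 * s by apply: leq_trans hv; apply: leq_addr.
have k0 : 0 < k.
  by case: (k) m3 => // ; rewrite exp0n // muln0 mul0n leqn0 expn_eq0; case: m m_gt0.
have mX : m <= 8 * k ^ 2 * #|X|.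
  have m20 : 0 < m ^ 2 by rewrite expn_gt0 m_gt0.
  rewrite -(leq_pmul2r m20) -expnS.
  by apply: leq_trans m3 _; rewrite -[leqRHS]mulnA leq_mul2l s_le orbT.
have X0 : 0 < #|X|.
  by move: mX; case: #|X| => //; rewrite muln0 leqn0; case: m m_gt0.
have hrem' : b * #|X :\: X'| <= 32 * k ^ 2 * m.
  have h1 : b * m * badpairs v <= 8 * k ^ 2 * (#|X| * m ^ 2).
    apply: leq_trans (leq_addl _ _) (leq_trans hv _).
    by rewrite leq_mul2l s_le orbT.
  have h2 : b * m * (#|X :\: X'| * #|X|) <= b * m * (4 * badpairs v).
    by rewrite leq_mul2l hrem orbT.
  have mX0 : 0 < m * #|X| by rewrite muln_gt0 m_gt0.
  rewrite -(leq_pmul2l mX0); move: h1 h2; move: (badpairs v) #|X| #|X :\: X'| b.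
  by move=> p x y bb; lia.
pose s' := \sum_(x in X') deg x.
have hs' : s <= s' + #|X :\: X'| * m ^ 2.
  rewrite es (bigID (fun x => x \in X')) /= leq_add //.
    rewrite /s' big_mkcond [leqRHS]big_mkcond /=; apply: leq_sum => x _.
    by case: (x \in X'); rewrite ?andbF ?andbT //; case: ifP.
  rewrite -sum_nat_const big_mkcond [leqRHS]big_mkcond /=; apply: leq_sum => x _.
  by rewrite in_setD andbC; case: ifP.
have s2s' : s <= 2 * s'.
  have h1 : m ^ 2 * (b * #|X :\: X'|) <= m ^ 2 * (32 * k ^ 2 * m).
    by rewrite leq_mul2l hrem' orbT.
  have h2 : 32 * k ^ 2 * m ^ 3 <= 32 * k ^ 2 * (8 * k ^ 2 * s).
    by rewrite leq_mul2l m3 orbT.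
  have h3 : 256 * k ^ 4 * (2 * (#|X :\: X'| * m ^ 2)) <= 256 * k ^ 4 * s.
    by move: h1 h2; rewrite /b; clear; clearbody s; move: #|X :\: X'| => y; lia.
  have k40 : 0 < 256 * k ^ 4 by rewrite muln_gt0 expn_gt0 k0.
  by rewrite leq_pmul2l // in h3; lia.
exists X'; split.
- by apply: subset_trans XA; apply/subsetP => x; rewrite inE => /andP[].
- pose R d := #|[set ee in setX E E | (dval ee.1 + dval ee.2)%R == d]|.
  have hR d : d \in sumset X' (oppset X') -> #|X| * m ^ 4 <= 2 * b ^ 2 * R d.
    move=> /diffsetP[x [x' [xX' x'X' ->]]].
    have [xX hx] : x \in X /\ 4 * nb x <= #|X| by move: xX'; rewrite inE => /andP.
    have [x'X hx'] : x' \in X /\ 4 * nb x' <= #|X| by move: x'X'; rewrite inE => /andP.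
    pose Zs := [set z in X | ~~ bad x z && ~~ bad z x'].
    have hZ : #|X| <= 2 * #|Zs|.
      have : #|X| <= #|Zs| + (nb x + nb x').
        apply: leq_trans (leq_add (leqnn _) (leq_card_setU _ _)).
        apply: leq_trans (leq_card_setU _ _).
        apply: subset_leq_card; apply/subsetP => z zX.
        rewrite !inE in zX *; rewrite zX /= (bad_sym x' z).
        by case: (bad x z); case: (bad z x').
      by lia.
    pose Om := [set w : U * (V * V) | [&& w.1 \in Zs,
      T x w.2.1 && T w.1 w.2.1 & T w.1 w.2.2 && T x' w.2.2]].
    have cOm : #|Om| = \sum_(z in Zs) codeg x z * codeg z x'.
      rewrite -sum1_card (eq_bigl (fun w : U * (V * V) => (w.1 \in Zs) &&
         ((T x w.2.1 && T w.1 w.2.1) && (T w.1 w.2.2 && T x' w.2.2)))); last first.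
        by move=> w; rewrite inE.
      rewrite -(pair_big_dep (fun z => z \in Zs) (fun z (w : V * V) =>
         (T x w.1 && T z w.1) && (T z w.2 && T x' w.2)) (fun _ _ => 1)) /=.
      apply: eq_bigr => z _; rewrite sum1_card /codeg -cardsX; apply: eq_card.
      by move=> [w w']; rewrite !inE.
    have hOm : #|X| * m ^ 4 <= 2 * b ^ 2 * #|Om|.
      apply: leq_trans (leq_mul hZ (leqnn _)) _.
      rewrite -[leqLHS]mulnA -[leqRHS]mulnA leq_mul2l /= cOm -sum_nat_const big_distrr /=.
      apply: leq_sum => z; rewrite inE => /andP[_ /andP[]].
      rewrite /bad -!leqNgt => h1 h2; have := leq_mul h1 h2.
      by move: (codeg x z) (codeg z x') => c c'; lia.
    apply: leq_trans hOm _; rewrite leq_mul2l; apply/orP; right.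
    (* A path from [x] through [w], [z], [w'] to [x'] is recovered from its two codes: the value
       [x - z] of the first gives [z], then [dat_inj] gives [w] and [w']. *)
    pose f (w : U * (V * V)) := (dat w.2.1 x w.1, dat w.2.2 w.1 x').
    rewrite -(card_in_imset (f := f) (D := Om)).
      apply: subset_leq_card; apply/subsetP => _ /imsetP[[z [w w']] + ->].
      rewrite !inE /= => /and3P[_ /andP[t1 t2] /andP[t3 t4]].
      by rewrite !datE // !datK // addrA subrK eqxx.
    move=> [z [w w']] [z1 [w1 w1']]; rewrite !inE /=.
    move=> /and3P[_ /andP[t1 t2] /andP[t3 t4]] /and3P[_ /andP[u1 u2] /andP[u3 u4]].
    rewrite /f /= => -[e1 e2].
    have ez : z = z1 by move: (congr1 dval e1); rewrite !datK //; apply: subrI.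
    subst z1; congr (_, (_, _)); first by apply: dat_inj e1.
    by apply: dat_inj e2.
  set Df := sumset X' _ in hR *.
  have h1 : #|Df| * (#|X| * m ^ 4) <= 2 * b ^ 2 * m ^ 6.
    rewrite -sum_nat_const; apply: (@leq_trans (\sum_(d in Df) 2 * b ^ 2 * R d)); first exact: leq_sum.
    rewrite -big_distrr /= leq_mul2l; apply/orP; right.
    apply: leq_trans (_ : #|setX E E| <= _); last first.
      by rewrite cardsX; have := leq_mul cardE cardE; lia.
    rewrite -sum1_card (partition_big (fun ee => (dval ee.1 + dval ee.2)%R) xpredT) //=.
    rewrite [leqLHS]big_mkcond /=; apply: leq_sum => d _; case: ifP => // _.
    rewrite /R sum1_card; apply: subset_leq_card; apply/subsetP => ee.
    by rewrite inE.
  have m50 : 0 < m ^ 5 by rewrite expn_gt0 m_gt0.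
  rewrite -/b -(leq_pmul2r m50).
  have h2 : #|Df| * m ^ 4 * m <= #|Df| * m ^ 4 * (8 * k ^ 2 * #|X|).
    by rewrite leq_mul2l mX orbT.
  have h3 : 8 * k ^ 2 * (#|Df| * (#|X| * m ^ 4)) <= 8 * k ^ 2 * (2 * b ^ 2 * m ^ 6).
    by rewrite leq_mul2l h1 orbT.
  by move: h2 h3; move: #|Df| #|X| b => x y bb; lia.
- rewrite -[\sum_(_ in _) _]/s'.
  by apply: leq_trans m3 _; have : k ^ 2 * s <= k ^ 2 * (2 * s'); [rewrite leq_mul2l s2s' orbT|lia].
Qed.

End BalogSzemerediGowers.

Lemma card_pairs_sum (S S' : finType) (P : S -> S' -> bool) :
  #|[set v : S * S' | P v.1 v.2]| = (\sum_x \sum_y nat_of_bool (P x y))%N.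
Proof. by rewrite card_sum pair_bigA. Qed.

(** * Small doubling on both axes of the grid *)

Section TwoSided.
Variables (F : finFieldType) (A1 A2 M : {set F}) (Q : {set F * F}) (m : nat).
Hypothesis m_gt0 : (0 < m)%N.
Hypothesis cardA1 : (#|A1| <= m)%N.
Hypothesis cardA2 : (#|A2| <= m)%N.
Hypothesis cardM : (#|M| <= m)%N.
Hypothesis M_neq0 : forall u, u \in M -> u != 0.
Hypothesis cardQ : forall u, (#|[set t | (t, u) \in Q]| <= m)%N.

Definition in_grid (x y u : F) : bool :=
  [&& x \in A1, y \in A2, u \in M & (x + u * y, u) \in Q].

(** Codes [(u, t, t')] made of two points in one row. With [y] fixed they give [x - x' = t - t'];
    with [x] fixed, [y - y' = (t - t') / u]. Hence one set of at most [m ^ 3] codes serves both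
    coordinates. *)
Let E : {set F * (F * F)} :=
  [set d | [&& d.1 \in M, (d.2.1, d.1) \in Q & (d.2.2, d.1) \in Q]].

Let cardE : (#|E| <= m ^ 3)%N.
Proof.
rewrite (_ : #|E| = \sum_(u in M) #|setX [set t | (t, u) \in Q] [set t | (t, u) \in Q]|)%N.
  apply: (@leq_trans (\sum_(u in M) m ^ 2)%N).
    by apply: leq_sum => u _; rewrite cardsX; apply: leq_mul; apply: cardQ.
  by rewrite sum_nat_const expnS leq_mul2r cardM orbT.
rewrite /E (card_pairs_sum (fun u (s : F * F) =>
  [&& u \in M, (s.1, u) \in Q & (s.2, u) \in Q])) [RHS]big_mkcond /=.
apply: eq_bigr => u _; case: (u \in M); last by rewrite big1.
by rewrite -card_sum; apply: eq_card => s; rewrite !inE.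
Qed.

(** The graph joins [x] to the pairs [(y, u)], and on the second pass [y] to the pairs [(x, u)] with
    [x] already in [X]. The density drops from [k] to [k1] after the first pass, and [c] is the
    doubling constant of the second, which dominates. Since [u] is nonzero, a code together with [x]
    determines [y]. *)
Lemma two_sided k k1 c :
  k1 = (16 * k ^ 2)%N -> c = (16 * k1 ^ 2 * (512 * k1 ^ 4) ^ 2)%N ->
  (m ^ 3 <= k * \sum_x \sum_y \sum_u nat_of_bool (in_grid x y u))%N ->
  exists X Y : {set F}, [/\ X \subset A1, Y \subset A2,
    (#|sumset X (oppset X)| <= c * m)%N, (#|sumset Y (oppset Y)| <= c * m)%N &
    (m ^ 3 <= 16 * k1 ^ 2 * \sum_(u in M)
      #|[set xy : F * F | [&& xy.1 \in X, xy.2 \in Y & in_grid xy.1 xy.2 u]]|)%N].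
Proof.
move=> ek1 ec hT.
have inA1 x y u : in_grid x y u -> x \in A1 by case/and4P.
have inA2 x y u : in_grid x y u -> y \in A2 by case/and4P.
have inM x y u : in_grid x y u -> u \in M by case/and4P.
have inQ x y u : in_grid x y u -> (x + u * y, u) \in Q by case/and4P.
pose T1 x (v : F * F) := in_grid x v.1 v.2.
pose dat1 (v : F * F) (x x' : F) := (v.2, (x + v.2 * v.1, x' + v.2 * v.1)).
pose dval1 (d : F * (F * F)) := d.2.1 - d.2.2.
have cB (A B : {set F}) : (#|A| <= m -> #|B| <= m -> #|setX A B| <= m ^ 2)%N.
  by move=> hA hB; rewrite cardsX expnS expn1 leq_mul.
have [] := @Balog_Szemeredi_Gowers F (F * F)%type (F * (F * F))%type T1 A1 (setX A2 M) E
  dat1 dval1 m k _ _ m_gt0 cardA1 (cB _ _ cardA2 cardM) cardE.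
- by move=> x [y u] /inA1.
- by move=> x [y u] h; rewrite inE (inA2 _ _ _ h) (inM _ _ _ h).
- by move=> x x' [y u] h h'; rewrite inE /= (inM _ _ _ h) (inQ _ _ _ h) (inQ _ _ _ h').
- by move=> x x' [y u] _ _; rewrite /dval1 /dat1 /=; ring.
- move=> x x' [y u] [y' u'] h _ _ _ [<- /addrI/mulfI e _].
  by rewrite (e (M_neq0 (inM _ _ _ h))).
- apply: leq_trans hT _; rewrite leq_mul2l; apply/orP; right.
  rewrite [leqRHS]big_mkcond /=; apply: leq_sum => x _.
  rewrite (card_pairs_sum (fun y u => in_grid x y u)); case: ifP => // xA.
  by rewrite big1 // => y _; rewrite big1 // => u _; rewrite /in_grid xA.
move=> X [XA hX hX3].
pose T2 y (v : F * F) := (v.1 \in X) && in_grid v.1 y v.2.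
pose dat2 (v : F * F) (y y' : F) := (v.2, (v.1 + v.2 * y, v.1 + v.2 * y')).
pose dval2 (d : F * (F * F)) := (d.2.1 - d.2.2) / d.1.
have [] := @Balog_Szemeredi_Gowers F (F * F)%type (F * (F * F))%type T2 A2 (setX A1 M) E
  dat2 dval2 m k1 _ _ m_gt0 cardA2 (cB _ _ cardA1 cardM) cardE.
- by move=> y [x u] /andP[_ /inA2].
- by move=> y [x u] /andP[_ h]; rewrite inE (inA1 _ _ _ h) (inM _ _ _ h).
- move=> y y' [x u] /andP[_ h] /andP[_ h'].
  by rewrite inE /= (inM _ _ _ h) (inQ _ _ _ h) (inQ _ _ _ h').
- move=> y y' [x u] /andP[_ h] _; rewrite /dval2 /dat2 /=.
  by field; apply: M_neq0 (inM _ _ _ h).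
- by move=> y y' [x u] [x' u'] _ _ _ _ [<- /addIr ->].
- apply: leq_trans hX3 _; rewrite ek1 leq_mul2l; apply/orP; right.
  rewrite (eq_bigr (fun x => \sum_(y in A2) \sum_u nat_of_bool (in_grid x y u))%N).
    rewrite exchange_big /=; apply: leq_sum => y yA.
    rewrite (card_pairs_sum (fun x u => (x \in X) && in_grid x y u)).
    by rewrite big_mkcond /=; apply: leq_sum => x _; case: (x \in X).
  move=> x _; rewrite (card_pairs_sum (fun y u => in_grid x y u)) [RHS]big_mkcond /=.
  apply: eq_bigr => y _; case: ifP => // yA.
  by rewrite big1 // => u _; rewrite /in_grid yA andbF.
move=> Y [YA hY hY3].
exists X, Y; split=> //.
- apply: leq_trans hX _; rewrite ec leq_mul2r; apply/orP; right.
  have kk1 : (k <= k1)%N by rewrite ek1; nia.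
  by do ?[apply: leq_mul => // | rewrite leq_exp2r // | rewrite leq_mul2l].
- by rewrite ec.
- apply: leq_trans hY3 _; rewrite leq_mul2l; apply/orP; right.
  rewrite (eq_bigr (fun y => \sum_(u in M) \sum_x
      nat_of_bool ((x \in X) && in_grid x y u))%N).
    rewrite exchange_big /=; apply: leq_sum => u _.
    rewrite (card_pairs_sum (fun x y => [&& x \in X, y \in Y & in_grid x y u])).
    rewrite [leqRHS]exchange_big big_mkcond /=; apply: leq_sum => y _.
    by case: (y \in Y).
  move=> y _; rewrite (card_pairs_sum (fun x u => (x \in X) && in_grid x y u)).
  rewrite exchange_big [RHS]big_mkcond /=; apply: eq_bigr => u _.
  case: ifP => // uM; rewrite big1 // => x _.
  by rewrite /in_grid uM !andbF.
Qed.

End TwoSided.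

(** * Dense grids *)

Section DenseGrid.
Variables (F : finFieldType) (X Y M : {set F}) (Q : {set F * F}).
Variables (R : F -> F -> F -> bool) (m k2 : nat).
Hypothesis m_gt0 : (0 < m)%N.
Hypothesis R_X : forall x y u, R x y u -> x \in X.
Hypothesis R_Y : forall x y u, R x y u -> y \in Y.
Hypothesis R_Q : forall x y u, R x y u -> (x + u * y, u) \in Q.
Hypothesis M_neq0 : forall u, u \in M -> u != 0.
Hypothesis cardX : (#|X| <= m)%N.
Hypothesis cardY : (#|Y| <= m)%N.
Hypothesis cardM : (#|M| <= m)%N.
Hypothesis cardQ : forall u, (#|[set t | (t, u) \in Q]| <= m)%N.
Let f u := #|[set xy : F * F | R xy.1 xy.2 u]|.
Hypothesis dense : (m ^ 3 <= k2 * \sum_(u in M) f u)%N.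

Let M' := [set u in M | \sum_(u in M) f u <= 2 * m * f u]%N.

Let M'_M u : u \in M' -> u \in M. Proof. by rewrite inE => /andP[]. Qed.

Let f_le u : (f u <= m ^ 2)%N.
Proof.
apply: (@leq_trans #|setX X Y|); last by rewrite cardsX expnS expn1 leq_mul.
apply: subset_leq_card; apply/subsetP => -[x y]; rewrite !inE => h.
by rewrite (R_X h) (R_Y h).
Qed.

Let denseM' : (m ^ 3 <= 2 * k2 * \sum_(u in M') f u)%N.
Proof.
have := popular (leqnn (\sum_(u in M) f u)%N) cardM.
have <- : (\sum_(u in M') f u = \sum_(u | (u \in M) &&
    (\sum_(u in M) f u <= 2 * m * f u)) f u)%N by apply: eq_bigl => u; rewrite inE.
move=> h; apply: leq_trans dense _; rewrite [(2 * k2)%N]mulnC -mulnA.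
by rewrite leq_mul2l h orbT.
Qed.

Let fM' u : u \in M' -> (m ^ 2 <= 2 * k2 * f u)%N.
Proof.
rewrite inE => /andP[_ h]; rewrite -(leq_pmul2l m_gt0) -expnS.
by apply: leq_trans dense _; have := leq_mul (leqnn k2) h; move: (f u) => y; lia.
Qed.

Let card_M' : (m <= 2 * k2 * #|M'|)%N.
Proof.
have m20 : (0 < m ^ 2)%N by rewrite expn_gt0 m_gt0.
rewrite -(leq_pmul2r m20) -expnS; apply: leq_trans denseM' _.
by rewrite -[leqRHS]mulnA leq_mul2l -sum_nat_const leq_sum ?orbT.
Qed.

Lemma dense_leq_cardX : (m <= 2 * k2 * #|X|)%N.
Proof.
have m20 : (0 < m ^ 2)%N by rewrite expn_gt0 m_gt0.
have [u uM'] : exists u, u \in M'.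
  by apply/card_gt0P; move: card_M'; case: #|M'| => //; rewrite muln0; lia.
have hf : (f u <= #|X| * m)%N.
  apply: (@leq_trans #|setX X Y|); last by rewrite cardsX leq_mul.
  apply: subset_leq_card; apply/subsetP => -[x y]; rewrite !inE => h.
  by rewrite (R_X h) (R_Y h).
rewrite -(leq_pmul2r m_gt0); have := fM' uM'.
by have := leq_mul (leqnn (2 * k2)%N) hf; move: (f u) => y; lia.
Qed.

(** A popular row carries at least [m ^ 2 / (2 k2)] pairs [(x, y)] but only [m] values
    [t = x + u y], so one value is taken by [m / (2 k2)] pairs, which their [x] distinguishes. *)
Let common_part u : u \in M' -> exists t (D : {set F}), [/\ D \subset X,
  forall x, x \in D -> exists2 y, y \in Y & x = t - u * y & (m <= 2 * k2 * #|D|)%N].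
Proof.
move=> uM'; have u0 : u != 0 := M_neq0 (M'_M uM').
have h : (f u <= \sum_(t | (t, u) \in Q)
    #|[set xy : F * F | R xy.1 xy.2 u && (xy.1 + u * xy.2 == t)%R]|)%N.
  rewrite /f -sum1_card (partition_big (fun xy => xy.1 + u * xy.2)
    (fun t => (t, u) \in Q)) /=.
    apply: leq_sum => t _; rewrite sum1_card; apply: subset_leq_card.
    by apply/subsetP => xy; rewrite unfold_in !inE.
  by move=> [x y]; rewrite inE => /R_Q.
have f0 : (0 < f u)%N.
  by have := fM' uM'; case: (f u) => //; rewrite muln0 leqn0 expn_eq0; case: m m_gt0.
have cQ : (#|[pred t | (t, u) \in Q]| <= m)%N.
  by apply: leq_trans (cardQ u); apply: subset_leq_card; apply/subsetP => t; rewrite !inE.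
have [t _ ht] := pigeonhole h cQ f0.
exists t, [set x | R x ((t - x) / u) u]; split.
- by apply/subsetP => x; rewrite inE => /R_X.
- move=> x; rewrite inE => /R_Y h'; exists ((t - x) / u) => //.
  by rewrite mulrC divfK // subKr.
- rewrite -(leq_pmul2l m_gt0); apply: leq_trans (fM' uM') _.
  set S := [set xy | _] in ht; set D := [set x | _].
  have : (#|S| <= #|D|)%N.
    rewrite -(card_in_imset (f := fst) (D := S)).
      apply: subset_leq_card; apply/subsetP => _ /imsetP[[x y] + ->].
      rewrite !inE /= => /andP[hR /eqP <-].
      by have -> : (x + u * y - x) / u = y by field.
    move=> [x y] [x' y']; rewrite !inE /= => /andP[_ /eqP e] /andP[_ /eqP e'] exx.
    by move: e; rewrite -e' exx => /addrI/(mulfI u0) ->.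
  move=> hSD; have := leq_mul (leqnn (2 * k2)%N) ht.
  by have := leq_mul (leqnn (2 * k2 * m)%N) hSD; move: #|D| #|S| (f u) => *; lia.
Qed.

Variables (H : {set F}) (K c : nat).
Hypothesis diffY : (#|sumset Y (oppset Y)| <= c * m)%N.
Hypothesis agH : approx_group K H.
Hypothesis coverX : covers K H X.
Hypothesis leq_XH : (#|X| <= 2 * #|H|)%N.
Hypothesis leq_HX : (#|H| <= K * #|X|)%N.

Let H_gt0 : (0 < #|H|)%N.
Proof. by have := dense_leq_cardX; case: #|H| leq_XH; lia. Qed.

Let K_gt0 : (0 < K)%N := approx_group_gt0 H_gt0 agH.

Let card_H : (#|H| <= K * m)%N.
Proof. by apply: leq_trans leq_HX _; rewrite leq_mul2l cardX orbT. Qed.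

Let kY := (2 * c * k2 * K ^ 3)%N.
Let kH := (2 * k2 * K ^ 3)%N.

Let diff_covers k (A : {set F}) :
  covers k H A -> covers (k ^ 2 * K) H (sumset A (oppset A)).
Proof.
move=> cA; have [oH cH] := agH; apply: (covers_trans _ cH).
rewrite -{2}oH expnS expn1; apply: covers_sum => //; exact: covers_opp.
Qed.

(* [D] lies in [X] and in a reflected translate of [u Y], so it controls both. *)
Let covers_fibre u : u \in M' -> covers kY H (dilate u Y) /\
  covers kH (sumset (dilate u Y) (oppset (dilate u Y))) H.
Proof.
move=> uM'; have [t [D [DX DY hD]]] := common_part uM'.
have u0 : u != 0 := M_neq0 (M'_M uM').
have D0 : (0 < #|D|)%N by case: #|D| hD => //; rewrite muln0; lia.
have DD (A : {set F}) : sumset D (oppset D) \subset A -> forall k (B : {set F}),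
    (#|sumset B D| <= k * #|D|)%N -> covers k A B.
  by move=> sA k B /(Ruzsa_covering D0); apply: covers_supset.
split.
(* As [D] lies in [t - u Y], the set [u Y + D] is no larger than [Y - Y], hence at most [2 c k2]
   times [#|D|]. Ruzsa covering gives translates of [D - D], inside [X - X], which costs another
   [K ^ 3]. *)
- have -> : kY = (2 * c * k2 * (K ^ 2 * K))%N by rewrite /kY -expnSr.
  apply: covers_trans (diff_covers coverX).
  apply: DD; first by apply: subset_sumset => //; apply: imsetS.
  apply: (@leq_trans #|sumset Y (oppset Y)|).
    rewrite -(card_dilate (sumset Y (oppset Y)) u0) dilate_sumset dilate_oppset.
    rewrite -(card_imset (sumset (dilate u Y) (oppset (dilate u Y))) (addIr t)).
    apply: subset_leq_card; apply/subsetP => _ /sumsetP[_ [x [/imsetP[y yY ->] xD ->]]].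
    have [y' y'Y ->] := DY x xD; apply/imsetP; exists (u * y - u * y'); last by ring.
    by apply: mem_diffset; apply: imset_f.
  apply: leq_trans diffY _; have := leq_mul (leqnn c) hD.
  by move: #|D| => d; clear; lia.
- apply: DD.
    apply/subsetP => _ /diffsetP[x [x' [/DY[y yY ->] /DY[y' y'Y ->] ->]]].
    have -> : t - u * y - (t - u * y') = u * y' - u * y by ring.
    by apply: mem_diffset; apply: imset_f.
  have : covers (1 * K * K) H (sumset H D).
    apply: (covers_trans _ agH.2).
    by apply: covers_sum; [exact: covers_refl | exact: covers_sub DX coverX].
  move=> /covers_card/leq_trans -> //; rewrite mul1n.
  have := leq_mul (leqnn (K * K)%N) card_H; have := leq_mul (leqnn (K ^ 3)%N) hD.
  by rewrite /kH; move: #|H| #|D| => h d; clear; lia.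
Qed.

Let k0 := (kH * (kY ^ 2 * K))%N.

(** Dilation by [u / v] carries [v Y - v Y] onto [u Y - u Y]; translates of the former cover [H],
    and translates of [H] cover the latter. *)
Let good_ratio u v : u \in M' -> v \in M' -> good_mult k0 H (u / v).
Proof.
move=> uM' vM'; have v0 : v != 0 := M_neq0 (M'_M vM').
have [cY _] := covers_fibre uM'; have [_ cH] := covers_fibre vM'.
apply: covers_trans (diff_covers cY).
have := covers_dilate (u / v) cH.
by rewrite dilate_sumset dilate_oppset dilateM divfK.
Qed.

Let g1 := (k0 ^ 4 * K ^ 4)%N.
Let g2 := (g1 ^ 2 * K ^ 2)%N.
Let g3 := (k0 ^ 2 * g2 * K)%N.
Hypothesis large : (8 * k2 ^ 2 * g3 ^ 2 * K ^ 2 < m)%N.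

Let k2_gt0 : (0 < k2)%N.
Proof. by case: k2 card_M' => //; rewrite muln0 mul0n; lia. Qed.

Let large_H : (2 * g3 ^ 2 <= #|H|)%N.
Proof.
have h : (m <= 4 * k2 * #|H|)%N.
  apply: leq_trans dense_leq_cardX _; have := leq_mul (leqnn (2 * k2)%N) leq_XH.
  by move: #|X| #|H| => x h; clear; lia.
have k20 : (0 < 4 * k2)%N by rewrite muln_gt0.
rewrite -(leq_pmul2l k20); apply: leq_trans h; apply: ltnW.
apply: leq_ltn_trans large.
have e : (0 < k2 * K ^ 2)%N by rewrite muln_gt0 k2_gt0 expn_gt0 K_gt0.
have := leq_mul (leqnn (8 * k2 * g3 ^ 2)%N) e.
by move: (g3) => g; clear; lia.
Qed.

Lemma dense_grid_subfield : exists (G : {set F}) (e u0 a a' : F),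
  [/\ is_subfield G, (#|G| <= 2 * g2 ^ 2 * K ^ 2 * m)%N &
   (m ^ 2 <= 2 * k2 * (K * kY * (4 * k2 * K ^ 3 * g2 ^ 2) ^ 2) *
     #|[set tu in Q | ((tu.1 - a - tu.2 * a')%R \in dilate e G)
                      && (tu.2 \in dilate u0 G)]|)%N].
Proof.
have [u0 u0M'] : exists u, u \in M'.
  by apply/card_gt0P; move: card_M'; case: #|M'| => //; rewrite muln0; lia.
have u0_neq0 : u0 != 0 := M_neq0 (M'_M u0M').
pose N := dilate u0^-1 M'.
have cN : #|N| = #|M'| by apply: card_dilate; rewrite invr_eq0.
have gN x : x \in N -> good_mult k0 H x.
  by move=> /imsetP[u uM' ->]; rewrite mulrC; apply: good_ratio.
have k0_gt0 : (0 < k0)%N := good_mult_gt0 H_gt0 (good_ratio u0M' u0M').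
have g1_gt0 : (0 < g1)%N by rewrite /g1 muln_gt0 !expn_gt0 k0_gt0 K_gt0.
have g2_gt0 : (0 < g2)%N by rewrite /g2 muln_gt0 !expn_gt0 g1_gt0 K_gt0.
have g23 : (g2 <= g3)%N.
  have := leq_mul (leqnn g2) (_ : 0 < k0 ^ 2 * K)%N.
  rewrite muln1 => /(_ _)/leq_trans; apply; first by rewrite muln_gt0 expn_gt0 k0_gt0.
  by rewrite /g3; move: g2 k0 => x y; clear; lia.
have g2H : (2 * g2 ^ 2 <= #|H|)%N.
  by apply: leq_trans large_H; rewrite leq_mul2l /= leq_exp2r.
(* One of the uses of [large]: [#|N| ^ 2] has order [m ^ 2], whereas the bound on the number of good
   multipliers has order [m]. *)
have mN2 : (8 * k2 ^ 2 * g3 ^ 2 * K ^ 2 * m < 4 * k2 ^ 2 * #|N| ^ 2)%N.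
  apply: (@leq_trans (m * m)); first by rewrite ltn_mul2r m_gt0 large.
  by apply: leq_trans (leq_mul card_M' card_M') _; rewrite cN; move: #|M'| => x; clear; lia.
have hN2 : (2 * g3 ^ 2 * K * #|H| < #|N| ^ 2)%N.
  have k20 : (0 < 4 * k2 ^ 2)%N by rewrite muln_gt0 expn_gt0 k2_gt0.
  rewrite -(ltn_pmul2l k20); apply: leq_ltn_trans mN2.
  have := leq_mul (leqnn (8 * k2 ^ 2 * g3 ^ 2 * K)%N) card_H.
  by move: (g3) #|H| => g h; clear; lia.
have N1 : (1 < #|N|)%N.
  have : (0 < 2 * g3 ^ 2 * K * #|H|)%N.
    have g3_gt0 : (0 < g3 ^ 2)%N by rewrite expn_gt0 (leq_trans g2_gt0 g23).
    exact: leq_trans (leq_mul (leq_mul (leq_mul (leqnn 2) g3_gt0) K_gt0) H_gt0).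
  by move: hN2; case: #|N| => [|[|]] //; rewrite ?exp0n ?exp1n //; lia.
have [G [subG NG gG]] := good_mult_subfield H_gt0 agH (erefl g1) (erefl g2) (erefl g3)
  N1 gN large_H hN2.
have [one_G subr_G div_G] := subG.
have zeroG : 0 \in G by rewrite -(subrr 1) subr_G.
have addG x y : x \in G -> y \in G -> x + y \in G.
  by move=> xG yG; rewrite -[y]opprK subr_G // -[- y]sub0r subr_G.
have mulG x y : x \in G -> y \in G -> x * y \in G.
  by move=> xG yG; rewrite -[y]invrK div_G // -[y^-1]mul1r div_G.
(* The set [D] below lies in both [e G] and [H + H] and has size comparable to [m]. Thus [H + D] is
   small relative to [D], and [H] is covered by translates of [D - D], which stays inside [e G]. *)
have [e e0 he] := good_mult_dense H_gt0 agH g2_gt0 gG g2H.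
set G' := [set x in G | _] in he; pose D := dilate e G'.
have cD : #|D| = #|G'| by apply: card_dilate.
have D_HH : D \subset sumset H H.
  by apply/subsetP => _ /imsetP[x + ->]; rewrite inE mulrC => /andP[].
have D_G : sumset D (oppset D) \subset dilate e G.
  apply/subsetP => _ /diffsetP[_ [_ [/imsetP[x xG ->] /imsetP[y yG ->] ->]]].
  by rewrite -mulrBr; apply: imset_f; move: xG yG; rewrite !inE => /andP[xG _] /andP[yG _]; apply: subr_G.
pose kG := (4 * k2 * K ^ 3 * g2 ^ 2)%N.
have mG : (m <= 4 * k2 * g2 ^ 2 * #|D|)%N.
  rewrite cD; apply: leq_trans card_M' _; rewrite -cN.
  have := leq_mul (leqnn (2 * k2)%N) (leq_trans (subset_leq_card NG) he).
  by move: #|N| #|G'| (g2) => x y z; clear; lia.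
have D0 : (0 < #|D|)%N by case: #|D| mG => //; rewrite muln0 leqNgt m_gt0.
have cHG : covers kG (dilate e G) H.
  apply: covers_supset D_G _; apply: Ruzsa_covering => //.
  apply: (@leq_trans #|sumset H (sumset H H)|).
    by apply: subset_leq_card; apply: subset_sumset.
  have : covers (1 * K * K) H (sumset H (sumset H H)).
    apply: (covers_trans _ agH.2).
    by apply: covers_sum; [exact: covers_refl | exact: agH.2].
  move=> /covers_card/leq_trans -> //; rewrite mul1n /kG.
  have := leq_mul (leqnn (K * K)%N) card_H; have := leq_mul (leqnn (K ^ 3)%N) mG.
  by move: #|H| #|D| (g2) => h d z; clear; lia.
(* Boundedly many pairs [(zx, zy)] of translates contain all triples, so one pair keeps a fixed
   proportion. For these, [t - zx - u (zy / u0) = (x - zx) + (u / u0) (u0 y - zy)] lies in [e G]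
   because [u / u0] is in [G]; this is the origin of [a] and [a']. *)
have [Zx cZx sX] := covers_trans coverX cHG.
have [Zy cZy sY] := covers_trans (covers_fibre u0M').1 cHG.
pose P zz (w : F * (F * F)) := [&& w.1 \in M', R w.2.1 w.2.2 w.1,
  (w.2.1 - zz.1 \in dilate e G) & (u0 * w.2.2 - zz.2 \in dilate e G)].
have hcount : (\sum_(u in M') f u <= \sum_(zz in setX Zx Zy) #|[set w | P zz w]|)%N.
  rewrite [leqRHS](_ : _ = \sum_(w : F * (F * F)) \sum_(zz in setX Zx Zy)
    nat_of_bool (P zz w))%N; last first.
    by rewrite exchange_big /=; apply: eq_bigr => zz _; rewrite card_sum.
  rewrite (_ : \sum_(u in M') f u = \sum_(w : F * (F * F))
     nat_of_bool ((w.1 \in M') && R w.2.1 w.2.2 w.1))%N; last first.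
    rewrite -(pair_bigA _ (fun u (xy : F * F) => nat_of_bool ((u \in M') && R xy.1 xy.2 u))) /=.
    rewrite big_mkcond; apply: eq_bigr => u _; case: ifP => uM' /=.
      by rewrite /f card_sum.
    by rewrite big1.
  apply: leq_sum => -[u [x y]] _ /=; case: andP => // -[uM' hR].
  have /sumsetP[zx [x' [zxZ x'G ex]]] := subsetP sX _ (R_X hR).
  have /sumsetP[zy [y' [zyZ y'G ey]]] := subsetP sY _ (imset_f (fun a => u0 * a) (R_Y hR)).
  rewrite (bigD1 (zx, zy)) /=; last by rewrite inE zxZ zyZ.
  rewrite /P /= uM' hR ex ey.
  by rewrite [zx + _ - _]addrC addKr x'G [zy + _ - _]addrC addKr y'G.
have cZ : (#|setX Zx Zy| <= K * kG * (kY * kG))%N by rewrite cardsX leq_mul.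
have S0 : (0 < \sum_(u in M') f u)%N.
  by move: denseM'; case: (\sum_(_ in M') _)%N => //; rewrite muln0 leqn0 expn_eq0; case: m m_gt0.
have [[zx zy] _ hz] := pigeonhole hcount cZ S0.
exists G, e, u0, zx, (zy / u0); split=> //.
  apply: leq_trans (card_good_mult H_gt0 agH g2_gt0 gG g2H) _.
  have := leq_mul (leqnn (2 * g2 ^ 2 * K)%N) card_H; move: #|H| (g2) => h z; clear; lia.
set tgt := [set tu in Q | _].
(* Since [u] is nonzero, a point [(t, u)] and [x] determine [y], so each point comes from at most
   [#|X|] triples. *)
have hP : (#|[set w | P (zx, zy) w]| <= m * #|tgt|)%N.
  rewrite mulnC; apply: (@leq_trans #|setX tgt X|); last first.
    by rewrite cardsX leq_mul2l cardX orbT.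
  pose h (w : F * (F * F)) := ((w.2.1 + w.1 * w.2.2, w.1), w.2.1).
  rewrite -(card_in_imset (f := h) (D := [set w | _])).
    apply: subset_leq_card; apply/subsetP => _ /imsetP[[u [x y]] + ->].
    rewrite inE /P /= => /and4P[uM' hR /imsetP[x' x'G ex] /imsetP[y' y'G ey]].
    have uG : u / u0 \in G.
      by apply: (subsetP NG); rewrite mulrC; apply: imset_f.
    rewrite /h !inE /= (R_X hR) (R_Q hR) andbT /=; apply/andP; split; last first.
      by apply/imsetP; exists (u / u0); rewrite // mulrC divfK.
    apply/imsetP; exists (x' + (u / u0) * y'); first by rewrite addG // mulG.
    rewrite mulrDr -ex [e * (_ * y')]mulrCA -ey.
    by field.
  move=> [u [x y]] [v [x' y']]; rewrite !inE /P /= => /and4P[uM' _ _ _] _ [e1 eu ex].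
  by move: e1; rewrite -eu -ex => /addrI/(mulfI (M_neq0 (M'_M uM'))) ->.
rewrite -(leq_pmul2l m_gt0) -expnS -/kG.
have := leq_trans denseM' (leq_mul (leqnn _) hz).
have := leq_mul (leqnn (K * kG * (kY * kG))%N) hP.
have -> x y z : (x * y * z ^ 2 = x * z * (y * z))%N by clear; lia.
move: (K * kG * (kY * kG))%N #|[set w | _]| #|tgt| => C1 C2 C3 h1 h2.
by move: h2 (leq_mul (leqnn (2 * k2)%N) h1); clear; lia.
Qed.
End DenseGrid.

(** * Polynomial bounds for the constants *)

Section PolyBounded.
Local Open Scope nat_scope.
Implicit Types g h : nat -> nat.

(** Starting at [k = 2] lets a numerical factor be absorbed into the exponent, so one exponent
    records the whole loss. *)
Definition poly_bounded g := exists c, forall k, 2 <= k -> g k <= k ^ c.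

Lemma poly_bounded_const n : poly_bounded (fun=> n).
Proof.
exists n => k k2; apply: leq_trans (ltnW (ltn_expl n (ltnSn 1))) _.
by case: n => // n; rewrite leq_exp2r.
Qed.

Lemma poly_bounded_id : poly_bounded id.
Proof. by exists 1 => k _; rewrite expn1. Qed.

Lemma poly_boundedM g h :
  poly_bounded g -> poly_bounded h -> poly_bounded (fun k => g k * h k).
Proof.
move=> [c hc] [d hd]; exists (c + d) => k k2; rewrite expnD.
by apply: leq_mul; [apply: hc | apply: hd].
Qed.

Lemma poly_boundedX g n : poly_bounded g -> poly_bounded (fun k => g k ^ n).
Proof.
move=> [c hc]; exists (c * n) => k k2; rewrite expnM.
by case: n => // n; rewrite leq_exp2r ?hc.
Qed.

End PolyBounded.

Ltac solve_poly_bounded := repeat first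
  [ assumption | apply: poly_bounded_const | apply: poly_bounded_id
  | apply: poly_boundedM | apply: poly_boundedX ].

Section GridConstants.
Local Open Scope nat_scope.

(** These functions reproduce the constants of the preceding lemmas in terms of the initial density
    [k]: [dens2] is [k2], [diff_const] is [c], [ag_const] is [K], [fibre_const] is [kY],
    [mult_const] is [k0], the next three are [g1], [g2], [g3], and [coset_const] is [kG]. *)
Definition dens1 k := 16 * k ^ 2.
Definition dens2 k := 16 * dens1 k ^ 2.
Definition diff_const k := 16 * dens1 k ^ 2 * (512 * dens1 k ^ 4) ^ 2.
Definition ag_const k := 64 * (diff_const k * (2 * dens2 k)) ^ 10.
Definition fibre_const k := 2 * diff_const k * dens2 k * ag_const k ^ 3.
Definition mult_const k :=
  2 * dens2 k * ag_const k ^ 3 * (fibre_const k ^ 2 * ag_const k).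
Definition quot_const k := mult_const k ^ 4 * ag_const k ^ 4.
Definition field_const k := quot_const k ^ 2 * ag_const k ^ 2.
Definition sum_const k := mult_const k ^ 2 * field_const k * ag_const k.
Definition coset_const k := 4 * dens2 k * ag_const k ^ 3 * field_const k ^ 2.


Lemma grid_constants_poly_bounded : exists c, forall k, 2 <= k ->
  [/\ 8 * dens2 k ^ 2 * sum_const k ^ 2 * ag_const k ^ 2 <= k ^ c,
      2 * field_const k ^ 2 * ag_const k ^ 2 <= k ^ c &
      2 * dens2 k * (ag_const k * fibre_const k * coset_const k ^ 2) <= k ^ c].
Proof.
have p1 : poly_bounded dens1 by rewrite /dens1; solve_poly_bounded.
have p2 : poly_bounded dens2 by rewrite /dens2; solve_poly_bounded.
have p3 : poly_bounded diff_const by rewrite /diff_const; solve_poly_bounded.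
have p4 : poly_bounded ag_const by rewrite /ag_const; solve_poly_bounded.
have p5 : poly_bounded fibre_const by rewrite /fibre_const; solve_poly_bounded.
have p6 : poly_bounded mult_const by rewrite /mult_const; solve_poly_bounded.
have p7 : poly_bounded quot_const by rewrite /quot_const; solve_poly_bounded.
have p8 : poly_bounded field_const by rewrite /field_const; solve_poly_bounded.
have p9 : poly_bounded sum_const by rewrite /sum_const; solve_poly_bounded.
have p10 : poly_bounded coset_const by rewrite /coset_const; solve_poly_bounded.
have [c1 h1] : poly_bounded
  (fun k => 8 * dens2 k ^ 2 * sum_const k ^ 2 * ag_const k ^ 2) by solve_poly_bounded.
have [c2 h2] : poly_bounded (fun k => 2 * field_const k ^ 2 * ag_const k ^ 2)
  by solve_poly_bounded.
have [c3 h3] : poly_bounded (fun k =>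
  2 * dens2 k * (ag_const k * fibre_const k * coset_const k ^ 2)) by solve_poly_bounded.
exists (c1 + c2 + c3) => k k2; have k0 : 0 < k by apply: ltnW.
split.
- by apply: leq_trans (h1 k k2) _; rewrite leq_pexp2l // -addnA leq_addr.
- by apply: leq_trans (h2 k k2) _; rewrite leq_pexp2l // -addnA addnCA leq_addr.
- by apply: leq_trans (h3 k k2) _; rewrite leq_pexp2l // leq_addl.
Qed.

End GridConstants.

Lemma grid_subfield : exists c, forall k, (2 <= k)%N ->
  forall (F : finFieldType) (A1 A2 M : {set F}) (Q : {set F * F}) (m : nat),
  (#|A1| <= m)%N -> (#|A2| <= m)%N -> (#|M| <= m)%N ->
  (forall u, u \in M -> u != 0) ->
  (forall u, #|[set t | (t, u) \in Q]| <= m)%N ->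
  (m ^ 3 <= k * \sum_x \sum_y \sum_u nat_of_bool (in_grid A1 A2 M Q x y u))%N ->
  (k ^ c < m)%N ->
  exists (G : {set F}) (e u0 a a' : F),
  [/\ is_subfield G, (#|G| <= k ^ c * m)%N &
   (m ^ 2 <= k ^ c * #|[set tu in Q | ((tu.1 - a - tu.2 * a')%R \in dilate e G)
                                      && (tu.2 \in dilate u0 G)]|)%N].
Proof.
have [c hc] := grid_constants_poly_bounded.
exists c => k k2 F A1 A2 M Q m cardA1 cardA2 cardM M_neq0 cardQ dense large.
have [hlarge hfield hcount] := hc k k2.
have m_gt0 : (0 < m)%N by apply: leq_ltn_trans large.
have [X [Y [XA YA hX hY dense2]]] := two_sided m_gt0 cardA1 cardA2 cardM M_neq0 cardQ
  (erefl (dens1 k)) (erefl (diff_const k)) dense.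
have cardX := leq_trans (subset_leq_card XA) cardA1.
have cardY := leq_trans (subset_leq_card YA) cardA2.
pose R x y u := [&& x \in X, y \in Y & in_grid A1 A2 M Q x y u].
have R_X x y u : R x y u -> x \in X by case/and3P.
have R_Y x y u : R x y u -> y \in Y by case/and3P.
have R_Q x y u : R x y u -> (x + u * y, u) \in Q by case/and3P=> _ _ /and4P[].
rewrite -/(dens2 k) in dense2.
have mX : (m <= 2 * dens2 k * #|X|)%N.
  exact: (dense_leq_cardX m_gt0 R_X R_Y cardX cardY cardM dense2).
have X0 : (0 < #|X|)%N by case: #|X| mX => //; rewrite muln0 leqNgt m_gt0.
have hXX : (#|sumset X (oppset X)| <= diff_const k * (2 * dens2 k) * #|X|)%N.
  by apply: leq_trans hX _; rewrite -mulnA leq_mul2l mX orbT.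
have [H [agH cX XH HX]] := ex_approx_group X0 hXX.
rewrite -/(ag_const k) in agH cX HX.
have [G [e [u0 [a [a' [subG cG hG]]]]]] := dense_grid_subfield m_gt0 R_X R_Y R_Q
  M_neq0 cardX cardY cardM cardQ dense2 hY agH cX XH HX (leq_ltn_trans hlarge large).
exists G, e, u0, a, a'; split=> //.
- by apply: leq_trans cG _; rewrite leq_mul2r hfield orbT.
- by apply: leq_trans hG _; rewrite leq_mul2r hcount orbT.
Qed.

(** * Incidences *)

Section Incidence.
Local Open Scope nat_scope.
Variables (X Y : finType).
Implicit Type r : X -> Y -> bool.

(** The only property of points and lines used for counting. It is symmetric in the two types, so
    each bound also holds in its dual form. *)
Definition no_rect r := forall x x' y y',
  r x y -> r x' y -> r x y' -> r x' y' -> x = x' \/ y = y'.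

(** Cauchy-Schwarz over [A]: two distinct elements of [B] share at most one neighbour, giving
    [#|B| ^ 2], and the diagonal returns the incidences. *)
Lemma incidence_Cauchy r (A : {set X}) (B : {set Y}) : no_rect r ->
  (forall x y, r x y -> x \in A) ->
  (\sum_(y in B) #|[set x | r x y]|) ^ 2 <=
    #|A| * (#|B| ^ 2 + \sum_(y in B) #|[set x | r x y]|).
Proof.
move=> rr rA; set s := \sum_(y in B) _.
pose e x := #|[set y in B | r x y]|.
have es : s = \sum_(x in A) e x.
  rewrite /s (eq_bigr (fun y => \sum_(x in A) nat_of_bool (r x y))).
    rewrite exchange_big /=; apply: eq_bigr => x _; rewrite /e card_sum big_mkcond /=.
    by apply: eq_bigr => y _; case: (y \in B).
  move=> y _; rewrite card_sum [RHS]big_mkcond /=; apply: eq_bigr => x _.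
  by case: (r x y) (rA x y) => [/(_ isT) ->|_] //; case: (x \in A).
rewrite [X in X ^ 2]es; apply: leq_trans (sum_Cauchy _ _) _.
rewrite leq_mul2l; apply/orP; right.
have -> : \sum_(x in A) e x ^ 2
    = \sum_(y in B) \sum_(y' in B) #|[set x in A | r x y && r x y']|.
  rewrite (eq_bigr (fun x => \sum_(y in B) \sum_(y' in B) nat_of_bool (r x y && r x y'))).
    rewrite exchange_big /=; apply: eq_bigr => y _.
    rewrite exchange_big /=; apply: eq_bigr => y' _; rewrite card_sum big_mkcond /=.
    by apply: eq_bigr => x _; case: (x \in A).
  move=> x _; rewrite expnS expn1.
  have -> : e x = \sum_(y in B) nat_of_bool (r x y).
    by rewrite /e card_sum [RHS]big_mkcond; apply: eq_bigr => y _; case: (y \in B).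
  rewrite big_distrlr /=; apply: eq_bigr => y _; apply: eq_bigr => y1 _; by rewrite mulnb.
have -> : #|B| ^ 2 + s = \sum_(y in B) (#|B| + #|[set x | r x y]|).
  by rewrite big_split /= sum_nat_const.
apply: leq_sum => y yB; rewrite (bigD1 y yB) /= addnC leq_add //.
  apply: (@leq_trans (\sum_(y' in B) 1)); last by rewrite sum1_card.
  rewrite big_mkcondr /=; apply: leq_sum => y' _; case: eqVneq => //= yy'.
  apply/card_le1P => x; rewrite inE => /and3P[_ h1 h2] x'; rewrite inE.
  apply/idP/eqP => [/and3P[_ h3 h4]|->].
    by case: (rr _ _ _ _ h1 h3 h2 h4) => // e'; rewrite e' eqxx in yy'.
  by rewrite h1 h2 (rA _ _ h1).
by apply: subset_leq_card; apply/subsetP => x; rewrite !inE => /and3P[].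
Qed.

(** With [s] incidences, [#|B| <= s / t], so the quadratic term of [incidence_Cauchy] is at most
    [s ^ 2 / 2] and can be moved to the left. *)
Lemma incidence_rich r (A : {set X}) (B : {set Y}) t : no_rect r ->
  (forall x y, r x y -> x \in A) ->
  (forall y, y \in B -> t <= #|[set x | r x y]|) -> 2 * #|A| <= t ^ 2 ->
  \sum_(y in B) #|[set x | r x y]| <= 2 * #|A|.
Proof.
move=> rr rA ht hA; have := @incidence_Cauchy r A B rr rA.
have : t * #|B| <= \sum_(y in B) #|[set x | r x y]|.
  by rewrite mulnC -sum_nat_const; apply: leq_sum.
move: (\sum_(y in B) _) #|A| #|B| hA => s a b hA hb /= hs.
rewrite leqNgt; apply/negP => hlt.
have t0 : 0 < t ^ 2.
  by rewrite expn_gt0; case: t hA {ht hb} => //; rewrite exp0n //; case: a hlt hs => //; nia.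
have h1 : t ^ 2 * s ^ 2 <= t ^ 2 * (a * (b ^ 2 + s)) by rewrite leq_mul2l hs orbT.
have h2 : a * ((t * b) * (t * b)) <= a * (s * s) by rewrite leq_mul2l leq_mul ?orbT.
have h3 : 2 * a * (s * s) <= t ^ 2 * (s * s) by rewrite leq_mul2r hA orbT.
have h4 : t ^ 2 * (s * (2 * a)) < t ^ 2 * (s * s).
  by rewrite !ltn_pmul2l //; apply: leq_ltn_trans hlt.
by move: h1 h2 h3 h4; rewrite ?expnS ?expn0; clear; lia.
Qed.

End Incidence.

Section Prune.
Local Open Scope nat_scope.
Variables (X Y : finType) (r : X -> Y -> bool) (A : {set X}) (B : {set Y}) (a t : nat).
Hypothesis rr : no_rect r.
Hypothesis rA : forall x y, r x y -> x \in A.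
Hypothesis rB : forall x y, r x y -> y \in B.
Hypothesis cardA : #|A| <= a.
Hypothesis cardB : #|B| <= a.
Hypothesis le_at : 2 * a <= t ^ 2.

Definition prune x y :=
  [&& r x y, #|[set x' | r x' y]| < t & #|[set y' | r x y']| < t].

Lemma card_prune : \sum_x \sum_y nat_of_bool (r x y) <=
  \sum_x \sum_y nat_of_bool (prune x y) + 4 * a.
Proof.
pose Y1 := [set y | t <= #|[set x | r x y]|].
pose X1 := [set x | t <= #|[set y | r x y]|].
have h1 : \sum_(y in Y1) #|[set x | r x y]| <= 2 * a.
  apply: leq_trans (incidence_rich (t := t) rr rA _ _) _.
  - by move=> y; rewrite inE.
  - by apply: leq_trans le_at; rewrite leq_mul2l.
  - by rewrite leq_mul2l.
have h2 : \sum_(x in X1) #|[set y | r x y]| <= 2 * a.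
  apply: leq_trans (@incidence_rich _ _ (fun y x => r x y) B X1 t _ _ _ _) _.
  - by move=> y y' x x' e1 e2 e3 e4; case: (rr e1 e3 e2 e4); [right|left].
  - by move=> y x /rB.
  - by move=> y; rewrite inE.
  - by apply: leq_trans le_at; rewrite leq_mul2l.
  - by rewrite leq_mul2l.
have -> : 4 * a = 2 * a + 2 * a by lia.
apply: leq_trans (leq_add (leqnn _) (leq_add h1 h2)).
have -> : \sum_(y in Y1) #|[set x | r x y]|
    = \sum_x \sum_y nat_of_bool ((y \in Y1) && r x y).
  rewrite exchange_big big_mkcond /=; apply: eq_bigr => y _; case: (y \in Y1) => /=.
    by rewrite card_sum.
  by rewrite big1.
have -> : \sum_(x in X1) #|[set y | r x y]|
    = \sum_x \sum_y nat_of_bool ((x \in X1) && r x y).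
  rewrite big_mkcond /=; apply: eq_bigr => x _; case: (x \in X1) => /=.
    by rewrite card_sum.
  by rewrite big1.
rewrite -!big_split /=; apply: leq_sum => x _; rewrite -!big_split /=.
apply: leq_sum => y _; rewrite /prune !inE !ltnNge.
by case: (r x y) => //=; case: (t <= _); case: (t <= _).
Qed.

End Prune.

(** * Three concurrent lines crossed by many lines *)

Section Configuration.
Local Open Scope nat_scope.
Variables (X Y : finType) (r : X -> Y -> bool) (A : {set X}) (B : {set Y}) (m k : nat).
Hypothesis rr : no_rect r.
Hypothesis rA : forall x y, r x y -> x \in A.
Hypothesis rB : forall x y, r x y -> y \in B.
Hypothesis cardA : #|A| <= m ^ 2.
Hypothesis cardB : #|B| <= m ^ 2.
Hypothesis degX : forall x, #|[set y | r x y]| <= m.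
Hypothesis m_gt0 : 0 < m.
Hypothesis dense : m ^ 3 <= k * \sum_x \sum_y nat_of_bool (r x y).
Hypothesis large : 2048 * k ^ 3 < m.

(** Here [l'] belongs to the pencil of [p] and [l] crosses it at [q]. As [l != l'] and [q != p], the
    line [l] cannot pass through [p]. *)
Definition joined (p : X) (l l' : Y) : bool :=
  (l != l') && [exists q, [&& q != p, r q l, r q l' & r p l']].

Let m2_gt0 : 0 < m ^ 2. Proof. by rewrite expn_gt0 m_gt0. Qed.

Let k_gt0 : 0 < k.
Proof.
by move: dense; case: k => //; rewrite mul0n leqn0 expn_eq0; case: m m_gt0.
Qed.

Let paths := \sum_p \sum_l \sum_l' nat_of_bool (joined p l l').

(** Paths [p], [l'], [q], [l] are counted from the middle incidence. Discarding poor points, then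
    poor lines, keeps a quarter of the [m ^ 3 / k] incidences, each extending in at least
    [(m / (8 k)) ^ 2] ways. *)
Let many_paths : m ^ 5 <= 256 * k ^ 3 * paths.
Proof.
pose dX q := #|[set l | r q l]|; pose dY l := #|[set q | r q l]|.
pose W := \sum_x \sum_y nat_of_bool (r x y).
have eW : W = \sum_(q in A) dX q.
  rewrite [RHS]big_mkcond; apply: eq_bigr => q _; case: ifP => qA.
    by rewrite /dX card_sum.
  by rewrite big1 // => l _; apply/eqP; rewrite eqb0; apply: contraFN qA => /rA.
pose P q := (q \in A) && (W <= 2 * m ^ 2 * dX q).
have h1 : W <= 2 * \sum_(q | P q) dX q.
  by apply: popular => //; rewrite eW.
pose W2 := \sum_(q | P q) dX q.
pose dY' l := #|[set q | P q && r q l]|.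
have eW2 : W2 = \sum_(l in B) dY' l.
  rewrite /W2 (eq_bigr (fun q => \sum_l nat_of_bool (r q l))); last first.
    by move=> q _; rewrite /dX card_sum.
  rewrite exchange_big [RHS]big_mkcond /=; apply: eq_bigr => l _; case: ifP => lB.
    by rewrite /dY' card_sum big_mkcond; apply: eq_bigr => q _; case: (P q).
  by rewrite big1 // => q _; apply/eqP; rewrite eqb0; apply: contraFN lB => /rB.
have h2 : W2 <= 2 * \sum_(l | (l \in B) && (W2 <= 2 * m ^ 2 * dY' l)) dY' l.
  by apply: popular => //; rewrite eW2.
(* The predecessor appears because a path must leave [q] by another line and [l'] by another point.
   [large] forces [d >= 2], so this costs only a factor 2. *)
have big_deg c d : c <= 4 -> W <= c * m ^ 2 * d -> m <= 8 * k * d.-1.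
  move=> c4 hd; have : m * m ^ 2 <= 4 * k * d * m ^ 2.
    rewrite -expnS; apply: leq_trans dense _.
    have := leq_mul (leqnn k) hd; have := leq_mul c4 (leqnn (k * m ^ 2 * d)).
    by clear; lia.
  rewrite leq_pmul2r // => hm; have : 4 * k < 4 * k * d.
    apply: leq_trans hm; apply: leq_ltn_trans large.
    have : k ^ 1 <= k ^ 3 by rewrite leq_pexp2l.
    by rewrite expn1; move: (k ^ 3) => z; clear; lia.
  case: d hm {hd} => [|[|d]]; rewrite ?muln0 ?muln1 ?ltnn //= => hm _; nia.
have h3 : m ^ 2 * W <= 256 * k ^ 2 * \sum_q \sum_l r q l * ((dX q).-1 * (dY l).-1).
  have : m ^ 2 * \sum_(l | (l \in B) && (W2 <= 2 * m ^ 2 * dY' l)) dY' l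
      <= 64 * k ^ 2 * \sum_q \sum_l r q l * ((dX q).-1 * (dY l).-1).
    rewrite exchange_big !big_distrr big_mkcond /=; apply: leq_sum => l _.
    case: ifP => // /andP[_ hl]; rewrite /dY' card_sum !big_distrr.
    apply: leq_sum => q _; case: (boolP (P q && r q l)) => [/andP[/andP[_ hq] ->]|_].
      have := leq_mul (big_deg 2 _ isT hq) (big_deg 4 (dY l) isT _) => /=.
      rewrite muln1 mul1n => /(_ _)/leq_trans hh.
      rewrite (_ : m ^ 2 = m * m) //; apply: hh; last by clear; lia.
      apply: leq_trans h1 _; rewrite -/W2.
      apply: leq_trans (leq_mul (leqnn 2) hl) _.
      have : dY' l <= dY l.
        by apply: subset_leq_card; apply/subsetP => x; rewrite !inE => /andP[].
      by move=> /(leq_mul (leqnn (4 * m ^ 2))); clear; lia.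
    by rewrite /= muln0.
  by have := leq_mul (leqnn (m ^ 2)) (leq_trans h1 (leq_mul (leqnn 2) h2)); lia.
(* The distinct lines [l] and [l'] determine their common point [q], so forgetting it loses no
   path. *)
have h4 : \sum_q \sum_l r q l * ((dX q).-1 * (dY l).-1) <= paths.
  have e q l' : r q l' * ((dX q).-1 * (dY l').-1)
      = \sum_p \sum_l nat_of_bool [&& r q l', q != p, r p l', l != l' & r q l].
    case: (boolP (r q l')) => hq; last by rewrite mul0n big1 // => p _; rewrite big1.
    rewrite mul1n /dX (cardsD1 l') inE hq /= /dY (cardsD1 q) inE hq /=.
    rewrite !card_sum mulnC big_distrlr /=; apply: eq_bigr => p _; apply: eq_bigr => l _.
    by rewrite !inE mulnb eq_sym !andbA.
  rewrite (eq_bigr (fun q => \sum_l' \sum_p \sum_l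
    nat_of_bool [&& r q l', q != p, r p l', l != l' & r q l])); last first.
    by move=> q _; apply: eq_bigr => l' _.
  rewrite exchange_big /=.
  rewrite (eq_bigr (fun l' => \sum_p \sum_l \sum_q
    nat_of_bool [&& r q l', q != p, r p l', l != l' & r q l])); last first.
    move=> l' _; rewrite exchange_big; apply: eq_bigr => p _.
    by rewrite exchange_big.
  rewrite exchange_big; apply: leq_sum => p _.
  rewrite exchange_big; apply: leq_sum => l _; apply: leq_sum => l' _.
  rewrite -card_sum.
  case: (set_0Vmem [set q | [&& r q l', q != p, r p l', l != l' & r q l]]) => [->|[q]].
    by rewrite cards0.
  rewrite inE => /and5P[h1q h2q h3q h4q h5q].
  have -> : joined p l l'.
    by rewrite /joined h4q; apply/existsP; exists q; rewrite h2q h5q h1q h3q.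
  apply/card_le1P => x; rewrite inE => hx x'; rewrite !inE.
  apply/idP/eqP => [/and5P[f1 _ _ _ f5]|-> //].
  move: hx => /and5P[g1 _ _ _ g5].
  by case: (rr f1 g1 f5 g5) => // e'; rewrite e' eqxx in h4q.
have h5 : m ^ 2 * m ^ 3 <= m ^ 2 * (k * W) by rewrite leq_mul2l dense orbT.
have h6 := leq_mul (leqnn (256 * k ^ 2 * k)) h4.
have h7 := leq_mul (leqnn k) h3.
by move: h5 h6 h7; clear; clearbody W; move: (\sum_q _) paths => u v; lia.
Qed.

Let joined_deg p l : #|[set l' | joined p l l']| <= m.
Proof.
apply: leq_trans (degX p); apply: subset_leq_card; apply/subsetP => l'.
by rewrite !inE => /andP[_ /existsP[q /and4P[]]].
Qed.

Let K := 256 * k ^ 3.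

Let many_triples p : m ^ 3 <= K * \sum_(l in B) #|[set l' | joined p l l']| ->
  m ^ 5 <= 32 * K ^ 3 * \sum_(l in B) \sum_(l1 | joined p l l1)
    \sum_(l2 | joined p l l2 && (l2 != l1)) #|[set l3 | [&& joined p l l3, l3 != l1 & l3 != l2]]|.
Proof.
pose N l := #|[set l' | joined p l l']| => hp.
have h1 := popular (leqnn (\sum_(l in B) N l)) cardB.
set V := \sum_(l in B) N l in h1; rewrite -/V in hp.
have h2 : m ^ 2 * \sum_(l | (l \in B) && (V <= 2 * m ^ 2 * N l)) N l <= 16 * K ^ 2 *
    \sum_(l in B) N l * (N l).-1 * (N l).-2.
  rewrite !big_distrr big_mkcond [leqRHS]big_mkcond /=; apply: leq_sum => l _.
  case: (l \in B) => //=; case: ifP => // hV.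
  have hN : m <= 2 * K * N l.
    rewrite -(leq_pmul2r m2_gt0) -expnS; apply: leq_trans hp _.
    by have := leq_mul (leqnn K) hV; clear; clearbody V; move: (N l) (K) => x y; lia.
  (* Guarantees that the [N (N - 1) (N - 2)] ordered triples of distinct lines number at least
     [N ^ 3 / 4]. *)
  have N4 : 4 < N l.
    rewrite ltnNge; apply/negP => N4.
    have := leq_trans hN (leq_mul (leqnn (2 * K)) N4); move: large; rewrite /K.
    by move: (k ^ 3) => x; clear; lia.
  have hN2 : m ^ 2 * N l <= (2 * K * N l) ^ 2 * N l by rewrite leq_mul2r leq_exp2r // hN orbT.
  apply: leq_trans hN2 _.
  have : N l * N l <= 4 * ((N l).-1 * (N l).-2) by move: N4; move: (N l) => x; clear; nia.
  by move=> /(leq_mul (leqnn (4 * K ^ 2 * N l))); move: (N l) (K) => x y; clear; lia.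
have h3 : \sum_(l in B) N l * (N l).-1 * (N l).-2 = \sum_(l in B) \sum_(l1 | joined p l l1)
    \sum_(l2 | joined p l l2 && (l2 != l1)) #|[set l3 | [&& joined p l l3, l3 != l1 & l3 != l2]]|.
  apply: eq_bigr => l _; rewrite -mulnA.
  rewrite {1}/N -sum_nat_const.
  rewrite (eq_bigl (joined p l)); last by move=> l1; rewrite inE.
  apply: eq_bigr => l1 h1l.
  have e1 : #|[set l2 | joined p l l2 && (l2 != l1)]| = (N l).-1.
    rewrite /N (cardsD1 l1 [set l' | joined p l l']) inE h1l /=.
    by apply: eq_card => l2; rewrite !inE andbC.
  rewrite -{1}e1 -sum_nat_const.
  rewrite (eq_bigl (fun l2 => joined p l l2 && (l2 != l1))); last by move=> l2; rewrite inE.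
  apply: eq_bigr => l2 /andP[h2l h21].
  rewrite -e1 (cardsD1 l2 [set l' | joined p l l' && _]) inE h2l h21 /=.
  by apply: eq_card => l3; rewrite !inE andbC andbA.
rewrite -h3.
have h4 := leq_mul (leqnn (m ^ 2)) hp; have h5 := leq_mul (leqnn (K * m ^ 2)) h1.
have h6 := leq_mul (leqnn (2 * K)) h2.
move: h4 h5 h6; set s1 := \sum_(_ | _) N _; set s2 := \sum_(_ in _) _.
by clear; clearbody s1 s2 V; move: (K) => t; lia.
Qed.

(** A pigeonhole over at most [m ^ 2] points fixes [p]; another, over at most [m ^ 2] pairs of lines
    through [p], turns the order [m ^ 5] of [many_triples] into [m ^ 3]. *)
Lemma triple_configuration : exists p l1 l2, [/\ r p l1, r p l2, l1 != l2 &
  m ^ 3 <= 32 * (256 * k ^ 3) ^ 3 * #|[set w : Y * Y | [&& w.1 != l1, w.1 != l2,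
    joined p w.2 l1, joined p w.2 l2 & joined p w.2 w.1]]|].
Proof.
have joined_r p l l' : joined p l l' -> r p l'.
  by move=> /andP[_ /existsP[q /and4P[]]].
have joined_A p l l' : joined p l l' -> p \in A by move/joined_r/rA.
have joined_B p l l' : joined p l l' -> l \in B.
  by move=> /andP[_ /existsP[q /and4P[_ /rB]]].
have hpaths : m ^ 5 <= \sum_(p in A) K * \sum_(l in B) #|[set l' | joined p l l']|.
  apply: leq_trans many_paths _; rewrite -big_distrr leq_mul2l; apply/orP; right.
  rewrite /paths [leqRHS]big_mkcond /=; apply: leq_sum => p _; case: ifP => pA.
    rewrite [leqRHS]big_mkcond /=; apply: leq_sum => l _; rewrite -card_sum; case: ifP => // lB.
    rewrite leqNgt; apply/negP => /card_gt0P[l']; rewrite inE => /joined_B.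
    by rewrite lB.
  rewrite big1 // => l _; rewrite big1 // => l' _; apply/eqP; rewrite eqb0.
  by apply: contraFN pA => /joined_A.
have m5 : 0 < m ^ 5 by rewrite expn_gt0 m_gt0.
have [p pA hp] := pigeonhole hpaths cardA m5.
rewrite (expnD m 2 3) leq_pmul2l // in hp.
have h3 := many_triples hp.
pose S l1 l2 := #|[set w : Y * Y | [&& w.1 != l1, w.1 != l2,
    joined p w.2 l1, joined p w.2 l2 & joined p w.2 w.1]]|.
have h4 : m ^ 5 <= \sum_(ll in [set ll : Y * Y | [&& r p ll.1, r p ll.2 & ll.2 != ll.1]])
    32 * K ^ 3 * S ll.1 ll.2.
  apply: leq_trans h3 _; rewrite -big_distrr leq_mul2l; apply/orP; right => /=.
  rewrite [leqRHS](eq_bigl (fun ll => r p ll.1 && (r p ll.2 && (ll.2 != ll.1)))); last first.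
    by move=> ll; rewrite inE.
  rewrite -(pair_big_dep (fun l1 => r p l1) (fun l1 l2 => r p l2 && (l2 != l1)) S) /=.
  apply: leq_trans (_ : _ <= \sum_l \sum_(l1 | joined p l l1)
    \sum_(l2 | joined p l l2 && (l2 != l1)) #|[set l3 | [&& joined p l l3, l3 != l1 & l3 != l2]]|) _.
    by rewrite big_mkcond; apply: leq_sum => l _; case: ifP.
  rewrite (exchange_big_dep (fun l1 => r p l1)) /=; last by move=> l l1 _ /joined_r.
  apply: leq_sum => l1 _.
  rewrite (exchange_big_dep (fun l2 => r p l2 && (l2 != l1))) /=; last first.
    by move=> l l2 _ /andP[/joined_r -> ->].
  apply: leq_sum => l2 /andP[_ h21]; rewrite /S.
  rewrite (card_pairs_sum (fun l3 l => [&& l3 != l1, l3 != l2, joined p l l1, joined p l l2 & joined p l l3])).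
  rewrite exchange_big big_mkcond; apply: leq_sum => l _; case: ifP => // /andP[hl1 /andP[hl2 _]].
  by rewrite card_sum; apply: leq_sum => l3 _; rewrite hl1 hl2 /=; case: (joined p l l3); rewrite ?andbT.
have cLL : #|[set ll : Y * Y | [&& r p ll.1, r p ll.2 & ll.2 != ll.1]]| <= m ^ 2.
  apply: leq_trans (leq_mul (degX p) (degX p)); rewrite -cardsX; apply: subset_leq_card.
  by apply/subsetP => ll; rewrite !inE => /and3P[-> ->].
have [[l1 l2]] := pigeonhole h4 cLL m5.
rewrite inE /= => /and3P[r1 r2 h21]; rewrite (expnD m 2 3) leq_pmul2l // => h5.
by exists p, l1, l2; rewrite eq_sym.
Qed.

End Configuration.

(** * The pencil of lines through a point *)

Section Lines.
Variable F : finFieldType.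
Implicit Types (p q z : F * F) (l : {set F * F}) (a b x y u : F).

Lemma line_through l p : is_line l -> p \in l -> exists a b,
  (a, b) != (0, 0) /\ l = [set z : F * F | a * (z.1 - p.1) + b * (z.2 - p.2) == 0].
Proof.
move=> [a [b [c [ab0 ->]]]]; rewrite inE => /eqP hp; exists a, b; split=> //.
apply/setP => z; rewrite !inE -hp -(subr_eq0 (_ + _)); congr (_ == _); ring.
Qed.

Lemma line_proportional a b c d : (a, b) != (0, 0) -> (c, d) != (0, 0) ->
  a * d = b * c -> exists2 t, t != 0 & c = t * a /\ d = t * b.
Proof.
move=> ab cd e.
have [a0|a0] := eqVneq a 0.
  have b0 : b != 0 by apply: contraNneq ab => ->; rewrite a0.
  have c0 : c = 0 by apply: (mulfI b0); rewrite -e a0 mul0r mulr0.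
  have d0 : d != 0 by apply: contraNneq cd => ->; rewrite c0.
  exists (d / b); first by rewrite mulf_neq0 ?invr_eq0.
  by rewrite c0 a0 mulr0 divfK.
have ed : d = c / a * b by rewrite mulrAC -[c * b]mulrC -e [a * d]mulrC mulfK.
exists (c / a); last by rewrite divfK.
rewrite mulf_neq0 ?invr_eq0 //; apply: contraNneq cd => c0.
by rewrite ed c0 !mul0r.
Qed.

Lemma lines_meet_once l l' p q : is_line l -> is_line l' ->
  p \in l -> p \in l' -> q \in l -> q \in l' -> p = q \/ l = l'.
Proof.
move=> Ll Ll' pl pl' ql ql'.
have [a [b [ab el]]] := line_through Ll pl.
have [c [d [cd el']]] := line_through Ll' pl'.
move: ql ql'; rewrite el el' !inE => /eqP hq /eqP hq'.
have [e|/eqP ne] := eqVneq (a * d) (b * c).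
  have [t t0 [-> ->]] := line_proportional ab cd e; right.
  apply/setP => z; rewrite !inE -!mulrA -mulrDr mulf_eq0 (negbTE t0).
  by [].
left; have D0 : a * d - b * c != 0 by rewrite subr_eq0; apply/eqP.
have h1 : (a * d - b * c) * (q.1 - p.1) = 0.
  have -> : (a * d - b * c) * (q.1 - p.1) = d * (a * (q.1 - p.1) + b * (q.2 - p.2))
    - b * (c * (q.1 - p.1) + d * (q.2 - p.2)) by ring.
  by rewrite hq hq' !mulr0 subrr.
have h2 : (a * d - b * c) * (q.2 - p.2) = 0.
  have -> : (a * d - b * c) * (q.2 - p.2) = a * (c * (q.1 - p.1) + d * (q.2 - p.2))
    - c * (a * (q.1 - p.1) + b * (q.2 - p.2)) by ring.
  by rewrite hq hq' !mulr0 subrr.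
move/eqP: h1; rewrite mulf_eq0 (negbTE D0) subr_eq0 => /eqP e1.
move/eqP: h2; rewrite mulf_eq0 (negbTE D0) subr_eq0 => /eqP e2.
by rewrite [p]surjective_pairing [q]surjective_pairing e1 e2.
Qed.

Section Pencil.
Variables (p : F * F) (a1 b1 a2 b2 : F).
Hypothesis det_neq0 : a1 * b2 - a2 * b1 != 0.

Definition form1 z := a1 * (z.1 - p.1) + b1 * (z.2 - p.2).
Definition form2 z := a2 * (z.1 - p.1) + b2 * (z.2 - p.2).

(* The projective map [z |-> (1 : form1 z : form2 z)] sends [p] to infinity, and
   with [t = 1 / form2 z] and [u = form1 z / form2 z] the lines through [p]
   become [u = const] and the others [t = x + u y]. *)
Definition ray u : {set F * F} := [set z | form1 z == u * form2 z].
Definition affine_line x y : {set F * F} := [set z | y * form1 z + x * form2 z == 1].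

Lemma forms_eq0 z : form1 z = 0 -> form2 z = 0 -> z = p.
Proof.
move=> h1 h2.
have e1 : (a1 * b2 - a2 * b1) * (z.1 - p.1) = 0.
  have -> : (a1 * b2 - a2 * b1) * (z.1 - p.1) = b2 * form1 z - b1 * form2 z.
    by rewrite /form1 /form2; ring.
  by rewrite h1 h2 !mulr0 subrr.
have e2 : (a1 * b2 - a2 * b1) * (z.2 - p.2) = 0.
  have -> : (a1 * b2 - a2 * b1) * (z.2 - p.2) = a1 * form2 z - a2 * form1 z.
    by rewrite /form1 /form2; ring.
  by rewrite h1 h2 !mulr0 subrr.
move/eqP: e1; rewrite mulf_eq0 (negbTE det_neq0) subr_eq0 => /eqP e1.
move/eqP: e2; rewrite mulf_eq0 (negbTE det_neq0) subr_eq0 => /eqP e2.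
by rewrite [p]surjective_pairing [z]surjective_pairing e1 e2.
Qed.

Lemma ray_form2 u z : z \in ray u -> z != p -> form2 z != 0.
Proof.
rewrite inE => /eqP h; apply: contraNneq => h2.
by apply/eqP; apply: forms_eq0 => //; rewrite h h2 mulr0.
Qed.

Lemma ray_inj : injective ray.
Proof.
move=> u v e.
pose D := a1 * b2 - a2 * b1.
pose z := (p.1 + (u * b2 - b1) / D, p.2 + (a1 - u * a2) / D).
have z1 : form1 z = u by rewrite /form1 /z /= /D; field.
have z2 : form2 z = 1 by rewrite /form2 /z /= /D; field.
have : z \in ray u by rewrite inE z1 z2 mulr1.
by rewrite e inE z1 z2 mulr1 => /eqP.
Qed.

Lemma forms_span a b : exists v w, forall z,
  a * (z.1 - p.1) + b * (z.2 - p.2) = v * form1 z + w * form2 z.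
Proof.
pose D := a1 * b2 - a2 * b1.
exists ((a * b2 - b * a2) / D), ((b * a1 - a * b1) / D) => z.
by rewrite /form1 /form2 /D; field.
Qed.

(** The two excluded lines are [u = 0] and [u = infinity]; the grid argument divides by [u]. *)
Lemma line_eq_ray l : is_line l -> p \in l -> l != [set z | form1 z == 0] ->
  l != [set z | form2 z == 0] -> exists2 u, u != 0 & l = ray u.
Proof.
move=> Ll pl n1 n2; have [a [b [ab el]]] := line_through Ll pl.
have [v [w hvw]] := forms_span a b.
have el' : l = [set z | v * form1 z + w * form2 z == 0].
  by rewrite el; apply/setP => z; rewrite !inE hvw.
have v0 : v != 0.
  apply: contraNneq n2 => v0; have [w0|w0] := eqVneq w 0.
    case/eqP: ab; have := hvw (p.1 + 1, p.2); have := hvw (p.1, p.2 + 1) => /=.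
    rewrite !v0 !w0 !mul0r !addr0 !subrr !mulr0 add0r addr0.
    by rewrite ![_ + 1 - _]addrC !addKr !mulr1 => -> ->.
  by apply/eqP; rewrite el'; apply/setP => z; rewrite !inE v0 mul0r add0r mulf_eq0 (negbTE w0).
have w0 : w != 0.
  apply: contraNneq n1 => w0; apply/eqP; rewrite el'; apply/setP => z.
  by rewrite !inE w0 mul0r addr0 mulf_eq0 (negbTE v0).
exists (- w / v); first by rewrite mulf_neq0 ?invr_eq0 ?oppr_eq0.
rewrite el'; apply/setP => z; rewrite !inE addr_eq0 -mulNr.
by rewrite -[RHS](inj_eq (mulfI v0)) mulrA [v * (_ / _)]mulrC divfK.
Qed.

Lemma line_eq_affine_line l : is_line l -> p \notin l -> exists x y, l = affine_line x y.
Proof.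
move=> [a [b [c [ab ->]]]]; rewrite inE => pl.
have [v [w hvw]] := forms_span a b.
pose g := c - (a * p.1 + b * p.2).
have g0 : g != 0 by rewrite subr_eq0 eq_sym.
exists (w / g), (v / g); apply/setP => z; rewrite !inE.
rewrite -[RHS](inj_eq (mulfI g0)) mulr1.
have -> : g * (v / g * form1 z + w / g * form2 z) = v * form1 z + w * form2 z by field.
by rewrite -hvw /g -subr_eq0 -[RHS]subr_eq0; congr (_ == _); ring.
Qed.

(** The rows are [1 - a form2 - a' form1], [form1] and [form2] in homogeneous coordinates; division
    by [form2] yields [(t - a - u a', u, 1)]. The parameters enter by row operations, so the
    determinant does not depend on them. *)
Definition pencil_mx a a' : 'M[F]_3 := \matrix_(i < 3, j < 3)
  nth 0 (nth [::] [:: [:: - a * a2 - a' * a1; - a * b2 - a' * b1;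
          1 + a * (a2 * p.1 + b2 * p.2) + a' * (a1 * p.1 + b1 * p.2)];
      [:: a1; b1; - (a1 * p.1 + b1 * p.2)];
      [:: a2; b2; - (a2 * p.1 + b2 * p.2)]] i) j.

Lemma pencil_mx_unit a a' : pencil_mx a a' \in unitmx.
Proof.
rewrite unitmxE unitfE.
suff -> : \det (pencil_mx a a') = a1 * b2 - a2 * b1 by [].
rewrite (expand_det_row _ ord0) !big_ord_recl big_ord0 /cofactor.
rewrite !(expand_det_row _ ord0) !big_ord_recl !big_ord0 /cofactor !det_mx11.
rewrite !mxE /= /bump /=.
by ring.
Qed.

Lemma pencil_mx_homog a a' q (t := (form2 q)^-1) (u := form1 q / form2 q) :
  form2 q != 0 ->
  same_proj (pencil_mx a a' *m homog q) (homog (t - a - u * a', u)).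
Proof.
move=> q0; apply/existsP; exists (form2 q); rewrite q0 /=; apply/eqP/colP => i.
rewrite !mxE !big_ord_recl big_ord0 !mxE /= /bump /=.
case: i => [[|[|[|i]]] hi] //=; rewrite /t /u; move: q0; rewrite /form1 /form2 => q0.
- by field.
- by field.
- by field.
Qed.

End Pencil.
End Lines.

(** * From the pencil to the grid *)

Section PencilGrid.
Variables (F : finFieldType) (P : {set F * F}) (r : F * F -> {set F * F} -> bool).
Variables (m k : nat) (p : F * F) (l1 l2 : {set F * F}).
Hypothesis r_P : forall q l, r q l -> q \in P.
Hypothesis r_line : forall q l, r q l -> is_line l.
Hypothesis r_mem : forall q l, r q l -> q \in l.
Hypothesis deg_line : forall l, (#|[set q | r q l]| <= m)%N.
Hypothesis deg_p : (#|[set l | r p l]| <= m)%N.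
Hypothesis r_pl1 : r p l1.
Hypothesis r_pl2 : r p l2.
Hypothesis l12 : l1 != l2.

Lemma pencil_subfield c : (m ^ 3 <= k * #|[set w : {set F * F} * {set F * F} |
    [&& w.1 != l1, w.1 != l2, joined r p w.2 l1, joined r p w.2 l2
      & joined r p w.2 w.1]]|)%N ->
  (forall (A1 A2 M : {set F}) (Q : {set F * F}),
    (#|A1| <= m)%N -> (#|A2| <= m)%N -> (#|M| <= m)%N ->
    (forall u, u \in M -> u != 0) ->
    (forall u, #|[set t | (t, u) \in Q]| <= m)%N ->
    (m ^ 3 <= k * \sum_x \sum_y \sum_u nat_of_bool (in_grid A1 A2 M Q x y u))%N ->
    exists (G : {set F}) (e u0 a a' : F),
    [/\ is_subfield G, (#|G| <= c * m)%N &
     (m ^ 2 <= c * #|[set tu in Q | ((tu.1 - a - tu.2 * a')%R \in dilate e G)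
                                    && (tu.2 \in dilate u0 G)]|)%N]) ->
  exists (G : {set F}) (e u0 : F) (T : 'M[F]_3),
  [/\ is_subfield G, (#|G| <= c * m)%N, T \in unitmx &
    (m ^ 2 <= c * #|setX (affine_image 0%R e G) (affine_image 0%R u0 G)
                    :&: proj_image T P|)%N].
Proof.
move=> dense grid.
have pl1 := r_mem r_pl1; have pl2 := r_mem r_pl2.
have [a1 [b1 [ab1 el1]]] := line_through (r_line r_pl1) pl1.
have [a2 [b2 [ab2 el2]]] := line_through (r_line r_pl2) pl2.
have det0 : a1 * b2 - a2 * b1 != 0.
  apply: contraNneq l12 => /eqP; rewrite subr_eq0 [a2 * b1]mulrC => /eqP e.
  have [t t0 [ea eb]] := line_proportional ab1 ab2 e.
  apply/eqP; rewrite el1 el2 ea eb; apply/setP => z; rewrite !inE -!mulrA -mulrDr.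
  by rewrite mulf_eq0 (negbTE t0).
pose f1 := form1 p a1 b1; pose f2 := form2 p a2 b2.
pose row u := ray p a1 b1 a2 b2 u.
have el1' : l1 = [set z | f1 z == 0] by rewrite el1.
have el2' : l2 = [set z | f2 z == 0] by rewrite el2.
(* On [l1] the form [f1] vanishes, so the line [y f1 + x f2 = 1] meets it where [x = 1 / f2]; on
   [l2] likewise [y = 1 / f1]. *)
pose A1 := [set (f2 q)^-1 | q in [set q | r q l1]].
pose A2 := [set (f1 q)^-1 | q in [set q | r q l2]].
pose M := [set u | (u != 0) && r p (row u)].
(* The point [p] lies on every row but goes to infinity; it is excluded because [f2 p = 0] has
   inverse 0 by convention. *)
pose Q := [set tu : F * F | (tu.2 \in M) &&
  [exists q, [&& q != p, r q (row tu.2) & tu.1 == (f2 q)^-1]]].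
have cA1 : (#|A1| <= m)%N by apply: leq_trans (leq_imset_card _ _) _.
have cA2 : (#|A2| <= m)%N by apply: leq_trans (leq_imset_card _ _) _.
have cM : (#|M| <= m)%N.
  apply: leq_trans deg_p; rewrite -(card_imset M (ray_inj (p := p) det0)).
  apply: subset_leq_card; apply/subsetP => _ /imsetP[u + ->].
  by rewrite !inE => /andP[].
have cQ u : (#|[set t | (t, u) \in Q]| <= m)%N.
  apply: leq_trans (deg_line (row u)).
  apply: leq_trans (leq_imset_card (fun q => (f2 q)^-1) _); apply: subset_leq_card.
  apply/subsetP => t; rewrite !inE /= => /andP[_ /existsP[q /and3P[_ rq /eqP ->]]].
  by apply: imset_f; rewrite inE.
have M0 u : u \in M -> u != 0 by rewrite inE => /andP[].
have joinedP l l' : joined r p l l' ->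
    [/\ p \notin l, is_line l & exists q, [/\ q \in l, r q l', q \in l', q != p & r p l']].
  move=> /andP[ll' /existsP[q /and4P[qp rql rql' rpl']]].
  split; [|exact: r_line rql|by exists q; rewrite (r_mem rql) (r_mem rql')].
  apply: contraNN ll' => pl; apply/eqP.
  have [e|//] := lines_meet_once (r_line rql) (r_line rql') (r_mem rql) (r_mem rql') pl (r_mem rpl').
  by rewrite e eqxx in qp.
have hgrid : (m ^ 3 <= k * \sum_x \sum_y \sum_u nat_of_bool (in_grid A1 A2 M Q x y u))%N.
  apply: leq_trans dense _; rewrite leq_mul2l; apply/orP; right.
  have -> : (\sum_x \sum_y \sum_u nat_of_bool (in_grid A1 A2 M Q x y u))%N
      = #|[set w : F * (F * F) | in_grid A1 A2 M Q w.1 w.2.1 w.2.2]|.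
    rewrite (card_pairs_sum (fun x (v : F * F) => in_grid A1 A2 M Q x v.1 v.2)).
    by apply: eq_bigr => x _; rewrite pair_bigA.
  (* Every counted pair [(l3, l)] is the image of a grid triple: [l3] is the row [u], and [l] is the
     line with coefficients [x], [y]. *)
  apply: leq_trans (leq_imset_card
    (fun w : F * (F * F) => (row w.2.2, affine_line p a1 b1 a2 b2 w.1 w.2.1)) _).
  apply: subset_leq_card; apply/subsetP => -[l3 l]; rewrite inE /=.
  move=> /and5P[n1 n2 /joinedP[pl Ll [q1 [q1l rq1 q1l1 _ _]]] /joinedP[_ _ [q2 [q2l rq2 q2l2 _ _]]]].
  move=> /joinedP[_ _ [q3 [q3l rq3 q3l3 q3p rp3]]].
  have [x [y el]] := line_eq_affine_line det0 Ll pl.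
  rewrite el1' in n1; rewrite el2' in n2.
  have [u u0 el3] := line_eq_ray det0 (r_line rp3) (r_mem rp3) n1 n2.
  apply/imsetP; exists (x, (y, u)); last by rewrite /= -el /row -el3.
  rewrite inE /in_grid /=; apply/and4P; split.
  - apply/imsetP; exists q1; first by rewrite inE.
    move: q1l q1l1; rewrite el el1' !inE /f1 => + /eqP f10; rewrite f10 mulr0 add0r => /eqP.
    by move=> h; rewrite ?/f1 ?/f2 -(mulr1_eq h) invrK.
  - apply/imsetP; exists q2; first by rewrite inE.
    move: q2l q2l2; rewrite el el2' !inE /f2 => + /eqP f20; rewrite f20 mulr0 addr0 => /eqP.
    by move=> h; rewrite ?/f1 ?/f2 -(mulr1_eq h) invrK.
  - by rewrite inE u0 /row -el3.
  - rewrite !inE /= u0 /row -el3 rp3 /=; apply/existsP; exists q3; rewrite q3p rq3 /=.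
    move: q3l q3l3; rewrite el el3 !inE => /eqP h /eqP e3; move: h; rewrite e3 mulrA -mulrDl => h.
    by rewrite /f2 -(mulr1_eq h) invrK addrC mulrC.
have [G [e [u0 [a [a' [subG cG hG]]]]]] := grid A1 A2 M Q cA1 cA2 cM M0 cQ hgrid.
exists G, e, u0, (pencil_mx p a1 b1 a2 b2 a a'); split=> //.
  exact: pencil_mx_unit.
apply: leq_trans hG _; rewrite leq_mul2l; apply/orP; right.
have inj : injective (fun tu : F * F => (tu.1 - a - tu.2 * a', tu.2)).
  by move=> [t u] [t' u'] /= [e1 e2]; move: e1; rewrite e2 => /addIr/addIr ->.
set tgt := [set tu in Q | _].
rewrite -(card_imset tgt inj); apply: subset_leq_card.
have affine0 b : dilate b G \subset affine_image 0 b G.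
  apply/subsetP => _ /imsetP[g gG ->]; apply/imsetP; exists g => //.
  by rewrite add0r.
apply/subsetP => _ /imsetP[[t u] + ->] /=.
rewrite inE => /andP[tuQ /andP[/(subsetP (affine0 _)) ht /(subsetP (affine0 _)) hu]].
rewrite !inE ht hu /=.
move: tuQ; rewrite !inE /= => /andP[_ /existsP[q /and3P[qp rq /eqP et]]].
apply/existsP; exists q; rewrite (r_P rq) /=.
have q0 : f2 q != 0 := ray_form2 det0 (r_mem rq) qp.
have eu : u = f1 q / f2 q.
  by have := r_mem rq; rewrite inE => /eqP h; rewrite /f1 h mulfK.
by rewrite et eu; apply: pencil_mx_homog.
Qed.
End PencilGrid.

(** * Incidence structure with integer parameters *)

Section FiniteIncidences.
Variables (F : finFieldType) (P : {set F * F}) (L : {set {set F * F}}).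
Hypothesis L_line : forall l, l \in L -> is_line l.

Definition incident (p : F * F) (l : {set F * F}) : bool :=
  [&& p \in P, l \in L & p \in l].

Lemma incident_no_rect : no_rect incident.
Proof.
move=> p q l l' /and3P[_ lL pl] /and3P[_ _ ql] /and3P[_ l'L pl'] /and3P[_ _ ql'].
exact: lines_meet_once (L_line lL) (L_line l'L) pl pl' ql ql'.
Qed.

Lemma card_incidences :
  #|incidences P L| = (\sum_p \sum_l nat_of_bool (incident p l))%N.
Proof.
rewrite -card_pairs_sum; apply: eq_card => -[p l].
by rewrite !inE /incident /= andbA.
Qed.

Lemma incidences_Cauchy :
  (#|incidences P L| ^ 2 <= #|P| * (#|L| ^ 2 + #|incidences P L|))%N.
Proof.
have := incidence_Cauchy (A := P) L incident_no_rect _.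
have -> : (\sum_(l in L) #|[set p | incident p l]|)%N = #|incidences P L|.
  rewrite card_incidences exchange_big big_mkcond /=; apply: eq_bigr => l _.
  case: ifP => lL; first by rewrite card_sum.
  by rewrite big1 // => p _; rewrite /incident lL andbF.
by apply=> p l /and3P[].
Qed.

End FiniteIncidences.

Lemma nat_incidence_structure : exists c, forall k, (2 <= k)%N ->
  forall (F : finFieldType) (P : {set F * F}) (L : {set {set F * F}}) (n : nat),
  (forall l, l \in L -> is_line l) ->
  (#|P| <= k * n ^ 2)%N -> (#|L| <= k * n ^ 2)%N ->
  (n ^ 3 <= k * #|incidences P L|)%N -> (k ^ c < n)%N ->
  exists (G : {set F}) (e u0 : F) (T : 'M[F]_3),
  [/\ is_subfield G, (#|G| <= k ^ c * n)%N, T \in unitmx &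
    (n ^ 2 <= k ^ c * #|setX (affine_image 0%R e G) (affine_image 0%R u0 G)
                    :&: proj_image T P|)%N].
Proof.
have [c0 grid] := grid_subfield.
pose k1 k := (16 * k ^ 4)%N; pose k2 k := (32 * (256 * k1 k ^ 3) ^ 3)%N.
have p1 : poly_bounded k1 by rewrite /k1; solve_poly_bounded.
have p2 : poly_bounded k2 by rewrite /k2; solve_poly_bounded.
have [c1 h1] : poly_bounded (fun k => 2048 * k1 k ^ 3)%N by solve_poly_bounded.
have [c2 h2] : poly_bounded (fun k => k2 k ^ c0 * (2 * k))%N by solve_poly_bounded.
have [c3 h3] : poly_bounded (fun k => 8 * k ^ 2)%N by solve_poly_bounded.
exists (c1 + c2 + c3)%N => k k_ge2 F P L n L_line cP cL dense large.
have k0 : (0 < k)%N by apply: ltnW.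
have n0 : (0 < n)%N by apply: leq_ltn_trans large.
have {}h1 : (2048 * k1 k ^ 3 < n)%N.
  apply: leq_ltn_trans large; apply: leq_trans (h1 k k_ge2) _.
  by rewrite leq_pexp2l // -addnA leq_addr.
have {}h2 : (k2 k ^ c0 * (2 * k) <= k ^ (c1 + c2 + c3))%N.
  apply: leq_trans (h2 k k_ge2) _.
  by rewrite leq_pexp2l // -addnA addnCA leq_addr.
have {}h3 : (8 * k ^ 2 < n)%N.
  apply: leq_ltn_trans large; apply: leq_trans (h3 k k_ge2) _.
  by rewrite leq_pexp2l // leq_addl.
(* The factor [2 k] gives [2 k n ^ 2 <= m ^ 2], the threshold at which pruning loses at most
   [4 k n ^ 2] incidences. As [8 k ^ 2 < n], this is at most half of the guaranteed [n ^ 3 / k]. *)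
pose m := (2 * k * n)%N.
have m0 : (0 < m)%N by rewrite !muln_gt0 k0.
have nm : (n <= m)%N by rewrite /m leq_pmull // muln_gt0 k0.
pose r0 := incident P L.
have r0_P p l : r0 p l -> p \in P by case/and3P.
have r0_L p l : r0 p l -> l \in L by case/and3P.
have le_m : (2 * (k * n ^ 2) <= m ^ 2)%N.
  have : (k * n ^ 2 <= k ^ 2 * n ^ 2)%N by rewrite leq_mul2r expnS expn1 leq_pmulr ?orbT.
  by rewrite /m; clear; lia.
have hprune := card_prune (incident_no_rect (P := P) L_line) r0_P r0_L cP cL le_m.
pose r := prune r0 m.
have rr0 p l : r p l -> r0 p l by case/and3P.
have r_no_rect : no_rect r.
  by move=> p q l l' /rr0 e1 /rr0 e2 /rr0 e3 /rr0 e4; apply: (incident_no_rect L_line e1 e2 e3 e4).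
have r_P p l : r p l -> p \in P by move/rr0/r0_P.
have r_L p l : r p l -> l \in L by move/rr0/r0_L.
have r_deg1 l : (#|[set p | r p l]| <= m)%N.
  case: (set_0Vmem [set p | r p l]) => [->|[p]]; first by rewrite cards0.
  rewrite inE => /and3P[_ /ltnW h _]; apply: leq_trans h.
  by apply: subset_leq_card; apply/subsetP => q; rewrite !inE => /rr0.
have r_deg2 p : (#|[set l | r p l]| <= m)%N.
  case: (set_0Vmem [set l | r p l]) => [->|[l]]; first by rewrite cards0.
  rewrite inE => /and3P[_ _ /ltnW h]; apply: leq_trans h.
  by apply: subset_leq_card; apply/subsetP => q; rewrite !inE => /rr0.
have cPm : (#|P| <= m ^ 2)%N.
  by apply: leq_trans cP (leq_trans _ le_m); rewrite leq_pmull.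
have cLm : (#|L| <= m ^ 2)%N.
  by apply: leq_trans cL (leq_trans _ le_m); rewrite leq_pmull.
have rdense : (m ^ 3 <= k1 k * \sum_p \sum_l nat_of_bool (r p l))%N.
  pose I0 := (\sum_p \sum_l nat_of_bool (r0 p l))%N.
  set I1 := (\sum_p \sum_l nat_of_bool (r p l))%N.
  have d : (n ^ 3 <= k * I0)%N by rewrite /I0 -card_incidences.
  have h : (I0 <= I1 + 4 * (k * n ^ 2))%N := hprune.
  clearbody I0 I1.
  have {d}d : (n ^ 3 <= k * I1 + 4 * k ^ 2 * n ^ 2)%N.
    by apply: leq_trans d _; have := leq_mul (leqnn k) h; clear; lia.
  have e : (8 * k ^ 2 * n ^ 2 <= n * n ^ 2)%N by rewrite leq_mul2r (ltnW h3) orbT.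
  have {d}d : (n ^ 3 <= 2 * k * I1)%N by move: d e; rewrite !expnS !expn0; clear; lia.
  by have := leq_mul (leqnn (8 * k ^ 3)%N) d; rewrite /m /k1 !expnMn; clear; lia.
have [p [l1 [l2 [pl1 pl2 l12 htriple]]]] :=
  triple_configuration r_no_rect r_P r_L cPm cLm r_deg2 m0 rdense (leq_trans h1 nm).
have k2_ge2 : (2 <= k2 k)%N.
  have : (0 < (256 * k1 k ^ 3) ^ 3)%N.
    by rewrite expn_gt0 muln_gt0 expn_gt0 /k1 muln_gt0 expn_gt0 k0.
  by rewrite /k2; move: ((256 * k1 k ^ 3) ^ 3)%N => x; clear; lia.
have largem : (k2 k ^ c0 < m)%N.
  apply: leq_trans nm; apply: leq_ltn_trans large; apply: leq_trans h2.
  by rewrite leq_pmulr // muln_gt0.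
have r_line p' l : r p' l -> is_line l by move/r_L/L_line.
have r_mem p' l : r p' l -> p' \in l by move/rr0/and3P => [].
have [|G [e [u0 [T [subG cG uT hG]]]]] := pencil_subfield (c := (k2 k ^ c0)%N)
  r_P r_line r_mem r_deg1 (r_deg2 p) pl1 pl2 l12 htriple.
  move=> A1 A2 M Q a1 a2 aM M0 aQ hT.
  exact: grid _ k2_ge2 _ _ _ _ _ _ a1 a2 aM M0 aQ hT largem.
exists G, e, u0, T; split=> //.
  apply: leq_trans cG _; rewrite /m mulnA leq_mul2r.
  by rewrite h2 orbT.
apply: leq_trans (leq_trans _ hG) _; first by rewrite leq_exp2r.
rewrite leq_mul2r; apply/orP; right; apply: leq_trans h2.
by rewrite leq_pmulr // muln_gt0.
Qed.

(** * The theorem *)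

Lemma Bernoulli_le (R : realDomainType) (x : R) (n : nat) :
  0 <= x -> x <= 1 -> 1 - n%:R * x <= (1 - x) ^+ n.
Proof.
move=> x0 x1; elim: n => [|n IHn]; first by rewrite mul0r subr0 expr0.
rewrite exprS -natr1; have h : 0 <= 1 - x by rewrite subr_ge0.
have := ler_wpM2l h IHn; apply: le_trans.
have : 0 <= n%:R * x * x by rewrite !mulr_ge0 // ler0n.
by nra.
Qed.

(** Raising the exponent of [K] is harmless for [K >= 1] but not below 1. There
    [K >= 1 - 1 / (s + 1)] with [s >= 2 d], and Bernoulli's inequality gives [K ^ d >= 1/2]. *)
Lemma leq_exp_nearly_ge1 (R : realFieldType) (x s : R) (c d : nat) :
  0 < x -> 0 < s -> s <= x * (s + 1) -> 2 * d%:R <= s -> (c <= d)%N ->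
  x ^+ c <= 2 * x ^+ d.
Proof.
move=> x0 s0 xs ds cd; have [x1|x1] := leP 1 x.
  have : x ^+ c <= x ^+ d by rewrite ler_weXn2l.
  by have := exprn_ge0 d (ltW x0); lra.
have s1 : 0 < s + 1 by lra.
pose y := (s + 1)^-1.
have y0 : 0 <= y by rewrite invr_ge0 ltW.
have y1 : y <= 1 by rewrite invf_le1 //; lra.
have hx : 1 - y <= x.
  have -> : 1 - y = s / (s + 1) by rewrite /y; field; rewrite lt0r_neq0.
  by rewrite ler_pdivrMr.
have h1 : x ^+ c <= 1 by rewrite exprn_ile1 // ltW.
have h2 := Bernoulli_le d y0 y1.
have h3 : d%:R * y <= 2^-1 by rewrite /y ler_pdivrMr //; lra.
have h4 : (1 - y) ^+ d <= x ^+ d by rewrite lerXn2r // nnegrE ?subr_ge0 // ltW.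
by lra.
Qed.

Lemma powR_3half (R : realType) (x : R) : 0 <= x -> x `^ (3 / 2) = Num.sqrt x ^+ 3.
Proof.
by move=> x0; rewrite mulrC powRrM powR12_sqrt // -powR_mulrn // sqrtr_ge0.
Qed.

Theorem theorem19 (R : realType) :
  exists C : R, 0 < C /\
    forall (F : finFieldType) (P : {set F * F}) (L : {set {set F * F}})
           (N : nat) (K : R),
      (forall l : {set F * F}, l \in L -> is_line l) ->
      #|P| = N -> #|L| = N ->
      0 < K ->
      (C * K) `^ C < N%:R ->
      K^-1 * N%:R `^ (3 / 2) <= #|incidences P L|%:R ->
      exists (G1 G2 : {set F}) (a1 b1 a2 b2 : F) (M : 'M[F]_3),
        [/\ is_subfield G1 /\ is_subfield G2,
            #|G1|%:R <= C * K `^ C * N%:R `^ (1 / 2) /\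
            #|G2|%:R <= C * K `^ C * N%:R `^ (1 / 2),
            M \in unitmx
          & C^-1 * K `^ (- C) * #|P|%:R <=
            #|setX (affine_image a1 b1 G1) (affine_image a2 b2 G2)
              :&: proj_image M P|%:R].
Proof.
have [c structure] := nat_incidence_structure.
have [w wE] : exists w, w = (12 ^ c)%N by exists (12 ^ c)%N.
have w0 : (0 < w)%N by rewrite wE expn_gt0.
have [d [cd wd d12 d4]] : exists d, [/\ c < d, 8 * w <= 2 * d, 12 <= 2 * d & 4 <= d]%N.
  by exists (8 * w + c + 4)%N; clear -w0; split; lia.
(* An even integer makes the real powers ordinary ones and lets the square root of the size
   hypothesis be taken: [(C K) ^ d < sqrt N]. The final count requires [C >= 8 w], where [w] comes
   from [k <= 12 K]. *)
have [C CE] : exists C : R, C = (2 * d)%:R by exists (2 * d)%:R.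
have CdE : C = 2 * d%:R by rewrite CE natrM.
have C0 : 0 < C by rewrite CE ltr0n; apply: leq_trans d12.
have C12 : 12 <= C by rewrite CE (ler_nat R 12).
have powRC (x : R) : 0 <= x -> x `^ C = x ^+ (2 * d) by rewrite CE; apply: powR_mulrn.
exists C; split=> // F P L N K L_line cP cL K0 large dense.
rewrite powRC ?mulr_ge0 ?ltW // in large.
rewrite powRN !powRC ?ltW //.
have N0 : (0 < N)%N.
  by rewrite -(ltr0n R); apply: le_lt_trans large; rewrite exprn_ge0 // mulr_ge0 ?ltW.
pose s : R := Num.sqrt N%:R.
have s2 : s ^+ 2 = N%:R by rewrite sqr_sqrtr.
have s1 : 1 <= s by rewrite -sqrtr1 ler_sqrt ?ler1n.
have s0 : 0 < s by apply: lt_le_trans s1.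
rewrite powR_3half ?ler0n // -/s in dense.
rewrite div1r powR12_sqrt ?ler0n // -/s.
pose I : R := #|incidences P L|%:R.
have I0 : 0 <= I by rewrite ler0n.
have {}dense : s ^+ 3 <= K * I by rewrite -ler_pdivrMl.
have I_le : I <= s ^+ 3 + s ^+ 2.
  have := incidences_Cauchy P L_line; rewrite cP cL -(ler_nat R) natrM natrD !natrX -s2 -/I.
  move=> h; rewrite leNgt; apply/negP => hI.
  have s3 : 0 < s ^+ 3 by rewrite exprn_gt0.
  have s5 : 0 < s ^+ 5 by rewrite exprn_gt0.
  have s2' : 0 < s ^+ 2 by rewrite exprn_gt0.
  have : (s ^+ 3 + s ^+ 2) * s ^+ 3 < I * (I - s ^+ 2) by rewrite ltr_pM //; lra.
  have -> : (s ^+ 3 + s ^+ 2) * s ^+ 3 = s ^+ 2 * (s ^+ 2) ^+ 2 + s ^+ 5 by ring.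
  have -> : I * (I - s ^+ 2) = I ^+ 2 - s ^+ 2 * I by ring.
  by move: h; rewrite mulrDr; lra.
(* The Cauchy-Schwarz bound on incidences keeps [K] from being much below 1. *)
have K_ge : s <= K * (s + 1).
  have h : s ^+ 3 <= K * (s ^+ 3 + s ^+ 2) by apply: le_trans dense _; rewrite ler_pM2l.
  have s20 : 0 < s ^+ 2 by rewrite exprn_gt0.
  rewrite -(ler_pM2l s20); have -> : s ^+ 2 * s = s ^+ 3 by ring.
  by have -> : s ^+ 2 * (K * (s + 1)) = K * (s ^+ 3 + s ^+ 2) by ring.
have K_half : 2^-1 <= K by nra.
have CK_d : d%:R <= C * K.
  have -> : C * K = d%:R * (2 * K) by rewrite CdE; ring.
  by rewrite ler_peMr ?ler0n //; lra.
have s_gt : (C * K) ^+ d < s.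
  rewrite -(@ltr_pXn2r _ 2) ?nnegrE ?exprn_ge0 ?mulr_ge0 ?ltW //.
  by rewrite s2 -exprM mulnC.
have d_ge4 : 4 <= d%:R :> R by rewrite (ler_nat R 4).
have CK4 : 4 <= C * K by apply: le_trans CK_d.
have s_ge : 2 * C <= s.
  apply/ltW; apply: le_lt_trans s_gt.
  have h1 : (C * K) ^+ 2 <= (C * K) ^+ d.
    by rewrite ler_weXn2l //; [lra | apply: leq_trans d4].
  apply: le_trans h1; rewrite expr2.
  have h2 : d%:R * d%:R <= C * K * (C * K) by rewrite ler_pM.
  by rewrite CdE in h2 *; nra.
have K_pow : K ^+ c <= 2 * K ^+ (2 * d).
  apply: (@leq_exp_nearly_ge1 _ K s) => //; first by rewrite -CE.
  exact: leq_trans (ltnW cd) (leq_pmull _ _).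
(* As [K >= 1/2], the factor 8 makes [k > 4], which absorbs the 4 lost in replacing [N] by the
   square of the integer part of [sqrt N]. *)
pose k := (Num.truncn (8 * K)).+1.
have k_gt : 8 * K < k%:R by apply: truncnS_gt.
have k_le : k%:R <= 12 * K.
  have h : (Num.truncn (8 * K))%:R <= 8 * K by rewrite truncn_le; lra.
  by rewrite /k -natr1; lra.
have k4 : (4 < k)%N by rewrite -(ltr_nat R); lra.
pose n := Num.truncn s.
have n_le : n%:R <= s by rewrite truncn_le ltW.
have n_gt : s < n.+1%:R by apply: truncnS_gt.
have n1 : (1 <= n)%N by rewrite truncn_gt0.
have s_le2n : s <= 2 * n%:R.
  by have : 1 <= n%:R :> R by [rewrite ler1n]; move: n_gt; rewrite -natr1; lra.
have N_le : (N <= 4 * n ^ 2)%N.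
  rewrite -(ler_nat R) -s2 natrM natrX.
  have -> : 4%:R * n%:R ^+ 2 = (2 * n%:R) ^+ 2 :> R by ring.
  by rewrite lerXn2r // nnegrE ?mulr_ge0 ?ler0n // ltW.
have kn2 : (N <= k * n ^ 2)%N.
  by apply: leq_trans N_le _; rewrite leq_mul2r ltnW ?orbT.
have cPn : (#|P| <= k * n ^ 2)%N by rewrite cP.
have cLn : (#|L| <= k * n ^ 2)%N by rewrite cL.
have kI : (n ^ 3 <= k * #|incidences P L|)%N.
  rewrite -(ler_nat R) natrM natrX -/I.
  have h1 : n%:R ^+ 3 <= s ^+ 3 by rewrite lerXn2r // nnegrE ?ler0n // ltW.
  apply: le_trans h1 (le_trans dense _); rewrite ler_wpM2r //.
  by apply: le_trans (ltW k_gt); lra.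
have kc : k%:R ^+ c <= w%:R * K ^+ c.
  by rewrite wE natrX -exprMn lerXn2r // nnegrE; lra.
have k_large : (k ^ c < n)%N.
  rewrite -(ltr_nat R) natrX; apply: le_lt_trans kc _.
  have h1 : (C * K) ^+ c.+1 <= (C * K) ^+ d.
    by rewrite ler_weXn2l //; lra.
  have h2 : w%:R * K ^+ c <= (C * K) ^+ c.
    by rewrite wE natrX -exprMn lerXn2r ?ler_pM2r // nnegrE mulr_ge0 // ltW.
  have h3 : (C * K) ^+ c * 4 <= (C * K) ^+ c.+1.
    by rewrite exprSr ler_wpM2l // exprn_ge0 // mulr_ge0 // ltW.
  have h4 : 0 < w%:R * K ^+ c by rewrite mulr_gt0 ?ltr0n // exprn_gt0.
  by lra.
have [G [e [u0 [T [subG cG uT hG]]]]] :=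
  structure k (ltnW (ltnW (ltnW k4))) F P L n L_line cPn cLn kI k_large.
exists G, G, 0, e, 0, u0, T.
have kC : k%:R ^+ c <= 2 * w%:R * K ^+ (2 * d).
  apply: le_trans kc _; have -> : 2 * w%:R * K ^+ (2 * d) = w%:R * (2 * K ^+ (2 * d)) by ring.
  by rewrite ler_wpM2l.
have KC0 : 0 < K ^+ (2 * d) by rewrite exprn_gt0.
have wC : 8 * w%:R <= C.
  by rewrite CE -natrM ler_nat.
have hcard : #|G|%:R <= C * K ^+ (2 * d) * s.
  move: cG; rewrite -(ler_nat R) natrM natrX => /le_trans; apply.
  rewrite ler_pM ?exprn_ge0 //.
  apply: le_trans kC _; rewrite ler_wpM2r ?ltW //; have := ler0n R w; lra.
split; [by split | by split | by [] |].
rewrite cP -invfM ler_pdivrMl ?mulr_gt0 //.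
move: hG; set S := #|_|; rewrite -(ler_nat R) natrM !natrX => hG.
have h1 : N%:R <= 4 * n%:R ^+ 2 :> R by rewrite -natrX -(natrM R 4) ler_nat.
have h2 : k%:R ^+ c * S%:R <= 2 * w%:R * K ^+ (2 * d) * S%:R by rewrite ler_wpM2r.
have h3 : 8 * w%:R * K ^+ (2 * d) * S%:R <= C * K ^+ (2 * d) * S%:R.
  by rewrite !ler_wpM2r // ltW.
lra.
Qed.
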